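(* Let $\alpha>0$, $\beta>0$, let $n\ge 0$ be an integer, and for $t>0$ let $$R_n(t):=\frac{\beta}{h_n}\int_0^1[P_n(y)]^2\,w(y;t)\,\frac{dy}{1-y},\qquad S_n(t):=\frac{R_n(t)}{2n+1+\alpha+\beta},$$ where $w(y;t)=e^{-t/y}y^\alpha(1-y)^\beta$, $P_n$ is the monic orthogonal polynomial of degree $n$ for the weight $w(\cdot;t)$ on $[0,1]$, and $h_n=\int_0^1P_n^2w\,dy$. Then $S_n$ satisfies, for $t>0$, $$S_n''=\frac{3S_n-1}{2S_n(S_n-1)}(S_n')^2-\frac{S_n'}{t}+\frac{(S_n-1)^2}{t^2}\left[\frac{(2n+1+\alpha+\beta)^2}{2}S_n-\frac{\beta^2}{2S_n}\right]+\frac{\alpha S_n}{t}-\frac{S_n(S_n+1)}{2(S_n-1)},$$ which is the Painlevé V equation $P_V\left((2n+1+\alpha+\beta)^2/2,\,-\beta^2/2,\,\alpha,\,-1/2\right)$. Here $'$ denotes $d/dt$.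
   Context: $P_V(a,b,c,d)$ denotes the equation $y''=\left(\frac1{2y}+\frac1{y-1}\right)(y')^2-\frac{y'}{t}+\frac{(y-1)^2}{t^2}\left(ay+\frac by\right)+\frac{cy}{t}+\frac{d\,y(y+1)}{y-1}$. The polynomial $P_n$ and the constant $h_n$ depend on $t$, the dependence being suppressed in the notation. *)

(* Defs.v *)
From HB Require Import structures.
From mathcomp Require Export all_boot all_order all_algebra.
From mathcomp Require Export all_classical all_reals all_analysis.
Export Order.TTheory GRing.Theory Num.Theory.
Export numFieldNormedType.Exports.

Set Implicit Arguments.
Unset Strict Implicit.
Unset Printing Implicit Defensive.

Local Open Scope ring_scope.
Local Open Scope classical_set_scope.

(* Division by zero gives 0, so the values at the endpoints y = 0 and y = 1 are
   conventional; they do not affect Lebesgue integrals over [0, 1]. *)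
Definition weight (R : realType) (alpha beta t y : R) : R :=
  expR (- t / y) * y `^ alpha * (1 - y) `^ beta.

Definition int01 (R : realType) (f : R -> R) : R :=
  \int[@lebesgue_measure R]_(y in `[0%R, 1%R]) f y.

Definition monic_orthogonal_polynomials (R : realType) (w : R -> R)
    (P : nat -> {poly R}) : Prop :=
  [/\ forall n, P n \is monic,
      forall n, size (P n) = n.+1 &
      forall m n, m != n ->
        int01 (fun y => (P m).[y] * (P n).[y] * w y) = 0].

(* In the following three definitions [P t] is the family of monic orthogonal
   polynomials for the weight with parameter [t]. *)
Definition h_ (R : realType) (alpha beta : R) (P : R -> nat -> {poly R})
    (n : nat) (t : R) : R :=
  int01 (fun y => (P t n).[y] ^+ 2 * weight alpha beta t y).

Definition R_ (R : realType) (alpha beta : R) (P : R -> nat -> {poly R})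
    (n : nat) (t : R) : R :=
  beta / h_ alpha beta P n t *
  int01 (fun y => (P t n).[y] ^+ 2 * weight alpha beta t y / (1 - y)).

Definition S_ (R : realType) (alpha beta : R) (P : R -> nat -> {poly R})
    (n : nat) (t : R) : R :=
  R_ alpha beta P n t / (2 * n%:R + 1 + alpha + beta).

(* [derive1] and division are total operations, so being a solution of the
   differential equation at [t] includes that [y] is twice differentiable at [t]
   and that [y t] avoids the singular values 0 and 1. *)
Definition satisfies_PV (R : realType) (a b c d : R) (y : R -> R) (t : R)
    : Prop :=
  [/\ derivable y t 1, derivable (derive1 y) t 1, y t != 0, y t != 1 &
      derive1n 2 y t =
        (1 / (2 * y t) + 1 / (y t - 1)) * derive1 y t ^+ 2
        - derive1 y t / t
        + (y t - 1) ^+ 2 / t ^+ 2 * (a * y t + b / y t)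
        + c * y t / t
        + d * y t * (y t + 1) / (y t - 1)].

(* Main.v *)
From HB Require Import structures.
Require Import Defs.
From mathcomp Require Import measurable_realfun ring lra.

(* Write p = P_n and q = P_{n-1} / h_{n-1} (q = 0 when n = 0). With
   <f> = int f w, consider the moments <pp/y>, <pq/y>, <qq/y>, <pp/(1-y)>,
   <pq/(1-y)>, <qq/(1-y)>. Three kinds of relations tie them together:
   - integration by parts against the Pearson identity of w;
   - orthogonality tested on the polynomial quotients
     (q(c) p - p(c) q) / (y - c) for c = 0 and c = 1, and on one more division
     by y at c = 0, which yields quadratic relations;
   - orthogonality differentiated in t, which shows that y dp/dt and y dq/dt are
     constant linear combinations of p and q.
   Setting r = R_n, A = t <pq/y> and B = beta <pq/(1-y)>, they amount to a
   first-order riccati_orthogonal for (r, A, B) together with one algebraic relation, and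
   eliminating A and B gives Painleve V for r / (2n+1+alpha+beta). Moreover
   R_n - (2n+1+alpha+beta) = t <pp/y> / h_n > 0, so S_n > 1 and the equation is
   never singular. *)

Set Implicit Arguments.
Unset Strict Implicit.
Unset Printing Implicit Defensive.

Local Open Scope ring_scope.

(** * Elimination *)

(** The hypothesis on [ddr] is the equation for [dr] differentiated in [t]. Once the derivatives are
    substituted, what remains is rational in [r], [A], [B], and the auxiliary [A], [B] disappear
    modulo the one algebraic relation. *)
Lemma painleve_elimination (F : fieldType) (t al be n A B r dr ddr dA dB : F) :
  let k := 2 * n + 1 + al + be in
  t != 0 -> r != 0 -> r - k != 0 -> k != 0 -> (2 : F) != 0 ->
  t * dr = 2 * (r * A - (r - k) * B) + (r - be) * (r - k) - t * r ->
  t * dB = r * (A * (A - t)) / (r - k) - (r - k) * (B * (B + be)) / r ->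
  t * dA = A + t * dB ->
  (r - k) * (B * (B + be)) / r + r * (A * (A - t)) / (r - k) =
    (2 * A - t) * (B - n) - al * A ->
  dr + t * ddr = 2 * (dr * A + r * dA - dr * B - (r - k) * dB)
    + dr * (2 * r - be - k) - r - t * dr ->
  ddr / k = (3 * (r / k) - 1) / (2 * (r / k) * (r / k - 1)) * (dr / k) ^+ 2
    - (dr / k) / t
    + ((r / k) - 1) ^+ 2 / t ^+ 2 *
        (k ^+ 2 / 2 * (r / k) - be ^+ 2 / (2 * (r / k)))
    + al * (r / k) / t - (r / k) * (r / k + 1) / (2 * (r / k - 1)).
Proof.
move=> k t0 r0 rk0 k0 n2 Edr EdB EdA Erel Eddr.
have -> : ddr = (2 * (dr * A + r * dA - dr * B - (r - k) * dB)
    + dr * (2 * r - be - k) - r - t * dr - dr) / t.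
  by rewrite -Eddr; field.
have -> : dA = (A + t * dB) / t by rewrite -EdA; field.
have -> : dB = (r * (A * (A - t)) / (r - k)
    - (r - k) * (B * (B + be)) / r) / t.
  by rewrite -EdB; field.
have -> : dr = (2 * (r * A - (r - k) * B)
    + (r - be) * (r - k) - t * r) / t.
  by rewrite -Edr; field.
pose E := (r - k) * (B * (B + be)) / r + r * (A * (A - t)) / (r - k)
  - ((2 * A - t) * (B - n) - al * A).
have E0 : E = 0 by rewrite /E Erel subrr.
apply/eqP; rewrite -subr_eq0; apply/eqP.
(* The two sides differ by this multiple of the algebraic relation. *)
transitivity (- 2 * r / (k * t ^+ 2) * E); last by rewrite E0 mulr0.
have rk1 : r / k - 1 != 0.
  by rewrite -(mulfV k0) -mulrBl mulf_neq0// invr_neq0.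
(* Eliminating [al] lets [k] become a free variable, so that [field] meets the denominators [k] and
   [r - k] in atomic form. *)
have alE : al = k - 1 - 2 * n - be by rewrite /k; ring.
rewrite /E alE.
move: {alE Erel E0 Eddr EdA EdB Edr E} k k0 rk0 rk1 => k k0 rk0 rk1.
by field; rewrite t0 r0 rk0 k0 n2.
Qed.

(** * Relations between the moments *)

(** [X], [Y], [Z] are the moments of [pp], [pq], [qq] against [1/y]; the suffix 1 refers to
    [1/(1-y)] and the suffix 2 to [1/y^2]. The linear relations are solved for [X2], [Y2], [Z2] and
    the quadratic ones for [Z], [Z1]. *)
Lemma riccati_of_moment_relations (F : fieldType)
    (t al be n h X Y Z X1 Y1 Z1 X2 Y2 Z2 dh dX1 dY1 dY : F) :
  let k := 2 * n + 1 + al + be in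
  let r := be * X1 / h in let A := t * Y in let B := be * Y1 in
  t != 0 -> be != 0 -> h != 0 -> X != 0 -> X1 != 0 ->
  be * X1 - t * X = k * h ->
  t * X2 = be * X1 - al * X ->
  t * Y2 = be * Y1 - al * Y - n ->
  t * Z2 = be * Z1 - al * Z ->
  X * Z = Y * (Y - 1) -> X1 * Z1 = Y1 * (Y1 + 1) ->
  X * Z2 + X2 * Z = (2 * Y - 1) * Y2 ->
  dh = - X -> dX1 = 2 * (Y * X1 - X * Y1) - X - X1 ->
  dY1 = Z * X1 - X * Z1 -> dY = Z * X2 - X * Z2 ->
  [/\ t * (be * (dX1 * h - X1 * dh) / h ^+ 2) =
        2 * (r * A - (r - k) * B) + (r - be) * (r - k) - t * r,
      t * (be * dY1) =
        r * (A * (A - t)) / (r - k) - (r - k) * (B * (B + be)) / r,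
      t * (Y + t * dY) = A + t * (be * dY1) &
      (r - k) * (B * (B + be)) / r + r * (A * (A - t)) / (r - k) =
        (2 * A - t) * (B - n) - al * A].
Proof.
move=> k r A B t0 be0 h0 X0 X10 eh eX2 eY2 eZ2 q0 q1 q2 -> -> -> ->.
have eV (a b c : F) : a != 0 -> a * b = c -> b = c / a.
  by move=> a0 <-; rewrite mulrC mulKf.
(* With this form all denominators become monomials in [t], [be], [h], [X], [X1]. *)
have rE : r - k = t * X / h.
  by rewrite /r -(mulfK h0 k) -eh; field.
rewrite rE /r.
move: (eV _ _ _ t0 eX2) (eV _ _ _ t0 eY2) (eV _ _ _ t0 eZ2).
move=> {eX2 eY2 eZ2} eX2 eY2 eZ2.
have eZ := eV _ _ _ X0 q0; have eZ1 := eV _ _ _ X10 q1.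
split.
- by rewrite /A /B; field.
- by rewrite /A /B eZ eZ1; field; rewrite h0 be0 X0 X10 t0.
- by rewrite eX2 eZ2 /A; field.
- have : t * (X * Z2 + X2 * Z) = t * ((2 * Y - 1) * Y2) by rewrite q2.
  rewrite eX2 eY2 eZ2 => q3.
  (* The left side of the goal equals [t * be * (X * Z1 + X1 * Z)]. The term [2 * al * t * (X * Z)]
     compensates the [al] contributions inside [X2] and [Z2], so that [q2] applies. *)
  transitivity (t * (t * (X * ((be * Z1 - al * Z) / t)
     + (be * X1 - al * X) / t * Z)) + 2 * al * t * (X * Z)).
    by rewrite /A /B eZ eZ1; field; rewrite h0 be0 X0 X10 t0.
  by rewrite q3 q0 /A /B; field.
Qed.

(* [L k f] stands for the integral of f w / y^k and [M f] for that of
   f w / (1 - y). For [n = 0] the predecessor [n.-1] is harmless: then [q = 0]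
   and [f = 0] in [dual_q]. *)
Section Functionals.
Context (R : realFieldType) (alpha beta t : R).
Context (L : nat -> {scalar {poly R}}) (M : {scalar {poly R}}).
(** [M_shift] reflects [y/(1-y) = 1/(1-y) - 1]. [ibp] integrates the derivative of [f w], where
    [w'/w = t/y^2 + alpha/y - beta/(1-y)]. *)
Hypothesis L_shift : forall k f, L k.+1 ('X * f) = L k f.
Hypothesis M_shift : forall f, M ('X * f) = M f - L 0 f.
Hypothesis L0_gt0 : forall f,
  f != 0 -> (forall y, 0 <= y <= 1 -> 0 <= f.[y]) -> 0 < L 0 f.
Hypothesis ibp : forall f,
  L 0 f^`() + alpha * L 1 f + t * L 2 f - beta * M f = 0.
Context (n : nat) (p q : {poly R}).
Hypothesis p_monic : p \is monic.
Hypothesis size_p : size p = n.+1.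
Hypothesis size_q : (size q <= n)%N.
Hypothesis orth_p : forall f : {poly R}, (size f <= n)%N -> L 0 (p * f) = 0.
Hypothesis dual_q : forall f : {poly R},
  (size f <= n)%N -> L 0 (q * f) = f`_n.-1.

Lemma scalar_lincomb (F : {scalar {poly R}}) a b f g :
  F (a *: f - b *: g) = a * F f - b * F g.
Proof. by rewrite linearB/= !scalarZ. Qed.

Lemma div_polyX (f : {poly R}) (m : nat) : f`_0 = 0 -> (size f <= m.+1)%N ->
  exists g : {poly R},
    [/\ f = 'X * g, (size g <= m)%N & forall i, g`_i = f`_i.+1].
Proof.
move=> f0 sf; exists (drop_poly 1 f); split.
- rewrite mulrC -[LHS](poly_take_drop 1) expr1 [take_poly _ _](_ : _ = 0) ?add0r//.
  by apply/polyP => i; rewrite coef_take_poly coef0; case: i => //=; rewrite f0.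
- by rewrite size_drop_poly leq_subLR add1n.
- by move=> i; rewrite coef_drop_poly addn1.
Qed.

Lemma q_eq0 : n = 0%N -> q = 0.
Proof.
by move=> n0; apply/eqP; rewrite -size_poly_eq0 -leqn0 -n0.
Qed.

Lemma p_coefn : p`_n = 1.
Proof. by move/eqP: p_monic; rewrite /lead_coef size_p. Qed.

Lemma coef_ge_size (f : {poly R}) i : (size f <= i)%N -> f`_i = 0.
Proof. exact: nth_default. Qed.

Lemma p_neq0 : p != 0.
Proof. exact: monic_neq0. Qed.

(** A root at 0 would give [p = X r] with [r] of degree below [n]. Orthogonality then makes the
    integral of [X r^2] vanish, although this polynomial is nonnegative on [0, 1]. *)
Lemma p0_neq0 : p`_0 != 0.
Proof.
apply/eqP => p0; have [r [pE sr _]] := div_polyX p0 (eq_leq size_p).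
have r0 : r != 0.
  by apply: contraTneq p_neq0 => r0; rewrite pE r0 mulr0 eqxx.
suff : 0 < L 0 ('X * (r * r)) by rewrite mulrA -pE orth_p ?ltxx.
apply: L0_gt0; first by rewrite !mulf_neq0 ?polyX_eq0.
by move=> y /andP[y0 _]; rewrite 2!hornerM hornerX mulr_ge0// -expr2 sqr_ge0.
Qed.

(** The same argument at the other endpoint, with [(1 - X) r^2] as the nonnegative polynomial. *)
Lemma p1_neq0 : p.[1] != 0.
Proof.
apply/eqP => p1; have /factor_theorem[r pE] : root p 1 by apply/rootP.
have r0 : r != 0.
  by apply: contraTneq p_neq0 => r0; rewrite pE r0 mul0r eqxx.
have sr : (size r <= n)%N.
  by have := size_p; rewrite pE size_Mmonic ?monicXsubC// size_XsubC addn2 => -[->].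
suff : 0 < L 0 ((1%:P - 'X) * (r * r)).
  rewrite (_ : _ * _ = - (p * r)); last by rewrite pE; ring.
  by rewrite linearN orth_p// oppr0 ltxx.
apply: L0_gt0.
  by rewrite !mulf_neq0// -opprB oppr_eq0 polyXsubC_eq0.
move=> y /andP[_ y1]; rewrite 2!hornerM mulr_ge0 -?expr2 ?sqr_ge0//.
by rewrite !hornerE subr_ge0.
Qed.

Let h := L 0 (p * p).
Let X := L 1 (p * p).
Let Y := L 1 (p * q).
Let Z := L 1 (q * q).
Let X2 := L 2 (p * p).
Let Y2 := L 2 (p * q).
Let Z2 := L 2 (q * q).
Let X1 := M (p * p).
Let Y1 := M (p * q).
Let Z1 := M (q * q).

Lemma size_deriv_leq (f : {poly R}) m :
  (size f <= m.+1)%N -> (size f^`() <= m)%N.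
Proof.
have [->|f0] := eqVneq f 0; first by rewrite derivC size_poly0.
by move=> sf; rewrite -ltnS (leq_trans (lt_size_deriv f0)).
Qed.

(** * Quadratic relations from polynomial quotients at 0 and 1 *)

Lemma orth_kernel (g : {poly R}) : (size g <= n)%N ->
  (L 1 (p * ('X * g)) = 0) * (L 1 (q * ('X * g)) = g`_n.-1).
Proof. by move=> sg; rewrite 2!(mulrCA _ 'X) !L_shift orth_p// dual_q. Qed.

(* [g] is the Christoffel-Darboux kernel at 0. *)
Lemma kernel0 : exists g : {poly R}, [/\ 'X * g = q`_0 *: p - p`_0 *: q,
  (size g <= n)%N, g`_n.-1 = q`_0 & g`_0 = q`_0 * p`_1 - p`_0 * q`_1 ].
Proof.
have [|| g [gE sg gi]] := @div_polyX (q`_0 *: p - p`_0 *: q) n.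
- by rewrite coefB !coefZ mulrC subrr.
- rewrite (leq_trans (size_polyD _ _))// geq_max size_polyN.
  by rewrite !(leq_trans (size_scale_leq _ _)) ?size_p// leqW.
exists g; split => //; last by rewrite gi coefB !coefZ.
rewrite gi coefB !coefZ; case: (posnP n) => [n0|n0].
  by rewrite q_eq0// !coef0 mul0r mulr0 subrr.
by rewrite prednK// p_coefn mulr1 (coef_ge_size size_q) mulr0 subr0.
Qed.

Lemma kernel0_p : p`_0 * Y = q`_0 * X.
Proof.
have [g [gE sg _ _]] := kernel0.
have := (orth_kernel sg).1; rewrite gE mulrBr -!scalerAr scalar_lincomb.
by move/eqP; rewrite subr_eq0 => /eqP.
Qed.

Lemma kernel0_q : p`_0 * Z = q`_0 * (Y - 1).
Proof.
have [g [gE sg gn _]] := kernel0.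
have := (orth_kernel sg).2.
rewrite gE mulrBr -!scalerAr scalar_lincomb gn (mulrC q p) -/Y -/Z => e.
by rewrite mulrBr mulr1 -[X in _ - X]e; ring.
Qed.

(** Both [(X, Y)] and [(Y - 1, Z)] are proportional to the nonzero vector [(p(0), q(0))], so their
    determinant vanishes. *)
Lemma quad0 : X * Z = Y * (Y - 1).
Proof.
apply: (mulfI p0_neq0); rewrite mulrCA kernel0_q mulrCA [RHS]mulrA kernel0_p.
by rewrite mulrA.
Qed.

(** The analogue of [quad0] with the quotient by [X - 1]. Dividing [X - 1] by [1 - y] leaves the
    factor -1, whence [Y1 + 1] in place of [Y - 1]. *)
Lemma quad1 : X1 * Z1 = Y1 * (Y1 + 1).
Proof.
have [g gE] : exists g : {poly R}, q.[1] *: p - p.[1] *: q = g * ('X - 1%:P).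
  by apply/factor_theorem/rootP; rewrite !hornerE mulrC subrr.
have sg : (size g <= n)%N.
  have [->|g0] := eqVneq g 0; first by rewrite size_poly0.
  have : (size (g * ('X - 1%:P))%R <= n.+1)%N.
    rewrite -gE (leq_trans (size_polyD _ _))// geq_max size_polyN.
    by rewrite !(leq_trans (size_scale_leq _ _)) ?size_p// leqW.
  by rewrite size_Mmonic ?monicXsubC// size_XsubC addn2.
have gn : g`_n.-1 = q.[1].
  case: (posnP n) => [n0|n0].
    by rewrite coef_ge_size ?q_eq0 ?horner0// (leq_trans sg)// n0.
  have := congr1 (coefp n) gE.
  rewrite /= coefB !coefZ p_coefn (coef_ge_size size_q) mulrBr coefB.
  rewrite coefMX coefMC -(prednK n0) /= (coef_ge_size (i := n.-1.+1)).
    by rewrite mul0r subr0 mulr1 mulr0 subr0 => <-.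
  by rewrite prednK.
have shift f : M (f * (g * ('X - 1%:P))) = - L 0 (f * g).
  by rewrite !mulrBr mulr1 linearB/= mulrA mulrC M_shift; ring.
have e1 : p.[1] * Y1 = q.[1] * X1.
  have := shift p; rewrite orth_p// -gE mulrBr -!scalerAr scalar_lincomb.
  by rewrite oppr0 => /eqP; rewrite subr_eq0 => /eqP.
have e2 : p.[1] * Z1 = q.[1] * (Y1 + 1).
  have := shift q.
  rewrite dual_q// gn -gE mulrBr -!scalerAr scalar_lincomb (mulrC q p).
  by rewrite -/Y1 -/Z1 => e; rewrite mulrDr mulr1 -[X in _ + X]opprK -e; ring.
apply: (mulfI p1_neq0); rewrite mulrCA e2 mulrCA [RHS]mulrA e1.
by rewrite mulrA.
Qed.

(** A combination of [p] and [q] cancels the constant term of the kernel [g], which allows a second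
    division by [X]. Pairing the quotient [k] with [p] and [q] brings in the moments against
    [1/y^2]. *)
Lemma quad2 : X * Z2 + X2 * Z = (2 * Y - 1) * Y2.
Proof.
have [g [gE sg gn g0]] := kernel0.
have [|| k [kE sk ki]] := @div_polyX (g - p`_1 *: q + q`_1 *: p) n.
- by rewrite coefD coefB !coefZ g0; ring.
- rewrite (leq_trans (size_polyD _ _))// geq_max.
  rewrite (leq_trans (size_polyD _ _))/= ?geq_max ?size_polyN.
    by rewrite (leq_trans (size_scale_leq _ _)) ?size_p.
  by rewrite !(leq_trans (size_scale_leq _ _)) ?size_p// ?leqW.
have kn : k`_n.-1 = q`_1.
  rewrite ki; case: (posnP n) => [n0|n0].
    rewrite n0/= coefD coefB !coefZ !coef_ge_size ?size_p ?n0//.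
    - by rewrite !mulr0 subrr addr0.
    - by rewrite (leq_trans size_q)// n0.
    - by rewrite (leq_trans sg)// n0.
  rewrite prednK// coefD coefB !coefZ p_coefn (coef_ge_size size_q).
  by rewrite (coef_ge_size sg) mulr1 mulr0 subrr add0r.
have Lg f : L 1 (f * g) = q`_0 * L 2 (f * p) - p`_0 * L 2 (f * q).
  by rewrite -L_shift mulrCA gE mulrBr -!scalerAr scalar_lincomb.
have e1 : q`_0 * X2 - p`_0 * Y2 - p`_1 * Y + q`_1 * X = 0.
  have := (orth_kernel sk).1; rewrite -kE mulrDr mulrBr -!scalerAr => e.
  by rewrite -[RHS]e linearD linearB/= !scalarZ Lg.
have e2 : q`_0 * Y2 - p`_0 * Z2 - p`_1 * Z + q`_1 * (Y - 1) = 0.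
  have := (orth_kernel sk).2; rewrite -kE mulrDr mulrBr -!scalerAr kn.
  rewrite linearD linearB/= !scalarZ Lg (mulrC q p) -/Y -/Y2 -/Z -/Z2 => e.
  by rewrite mulrBr mulr1 -[X in _ + (_ - X)]e; ring.
apply: (mulfI p0_neq0); apply/eqP; rewrite -subr_eq0; apply/eqP.
have := kernel0_p; have := kernel0_q; have := quad0 => q0 eZ eY.
(* The multipliers [Y - 1] and [- X] remove [q_1]; the terms in [p_1] then form a multiple of
   [quad0], and the two kernel relations exchange [q_0] for [p_0]. *)
transitivity ((Y - 1) * (q`_0 * X2 - p`_0 * Y2 - p`_1 * Y + q`_1 * X)
  - X * (q`_0 * Y2 - p`_0 * Z2 - p`_1 * Z + q`_1 * (Y - 1))
  + X2 * (p`_0 * Z - q`_0 * (Y - 1)) - Y2 * (p`_0 * Y - q`_0 * X)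
  - p`_1 * (X * Z - Y * (Y - 1))); first by ring.
by rewrite e1 e2 eY eZ q0; ring.
Qed.

(** * Linear relations from integration by parts *)

Lemma ibpX f : L 0 ('X * f)^`() + alpha * L 0 f + t * L 1 f
  - beta * (M f - L 0 f) = 0.
Proof. by have := ibp ('X * f); rewrite !L_shift M_shift. Qed.

Lemma ibp_Xpp : beta * X1 - t * X = (2 * n%:R + 1 + alpha + beta) * h.
Proof.
have := ibpX (p * p); rewrite -/h -/X -/X1.
have -> : L 0 ('X * (p * p))^`() = (2 * n%:R + 1) * h.
  (* As [p] is monic of degree [n], the leading terms of [X p'] and [n p] cancel, so the first
     summand is orthogonal to [p]. *)
  have -> : ('X * (p * p))^`() =
      p * (('X * p^`() - n%:R%:P * p) *+ 2) + (2 * n%:R + 1) *: (p * p).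
    rewrite !derivM derivX -!mul_polyC rmorphD rmorphM/= !polyC_natr; ring.
  rewrite linearD linearZ/= orth_p ?add0r//; last first.
  rewrite -scaler_nat (leq_trans (size_scale_leq _ _))//.
  apply/leq_sizeP => i; rewrite leq_eqVlt => /predU1P[<-|ni].
    rewrite coefB coefCM p_coefn coefXM; case: (posnP n) => [->|n0].
      by rewrite /= mul0r subrr.
    by rewrite coef_deriv prednK// p_coefn mulr1 subrr.
  rewrite coefB coefCM (coef_ge_size (f := p)) ?size_p// mulr0 subr0.
  rewrite coefXM eqn0Ngt (leq_ltn_trans _ ni)// coef_deriv prednK.
    by rewrite (coef_ge_size (f := p)) ?size_p// mul0rn.
  by rewrite (leq_ltn_trans _ ni).
by move=> e; apply/eqP; rewrite -subr_eq0 -oppr_eq0 -e; apply/eqP; ring.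
Qed.

Lemma ibp_pp : t * X2 = beta * X1 - alpha * X.
Proof.
have := ibp (p * p); rewrite derivM (mulrC _ p) linearD/= orth_p; last first.
  by apply: size_deriv_leq; rewrite size_p.
by rewrite -/X -/X1 -/X2 => e; rewrite -[LHS]addr0 -[X in _ = X]addr0 -[in RHS]e; ring.
Qed.

(** The constant [n] is the coefficient of degree [n - 1] of [p'], read off by [q]; the part [p q']
    vanishes by orthogonality. *)
Lemma ibp_pq : t * Y2 = beta * Y1 - alpha * Y - n%:R.
Proof.
have := ibp (p * q); rewrite derivM (mulrC _ q) linearD/= orth_p; last first.
  by apply: size_deriv_leq; rewrite leqW.
rewrite dual_q; last by apply: size_deriv_leq; rewrite size_p.
have -> : p^`()`_n.-1 = n%:R.
  case: (posnP n) => [n0|n0]; last by rewrite coef_deriv prednK// p_coefn.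
  by rewrite n0 coef_deriv coef_ge_size ?mul0rn// size_p n0.
by rewrite -/Y -/Y1 -/Y2 => e; rewrite -[X in _ = X]addr0 -[in RHS]e; ring.
Qed.

Lemma ibp_qq : t * Z2 = beta * Z1 - alpha * Z.
Proof.
have := ibp (q * q); rewrite derivM (mulrC _ q) linearD/= dual_q; last first.
  by apply: size_deriv_leq; rewrite leqW.
have -> : q^`()`_n.-1 = 0.
  case: (posnP n) => [n0|n0]; first by rewrite q_eq0// derivC coef0.
  by rewrite coef_deriv prednK// (coef_ge_size size_q) mul0rn.
by rewrite -/Z -/Z1 -/Z2 => e; rewrite -[X in _ = X]addr0 -[in RHS]e; ring.
Qed.

(** * Ladder relations and derivatives of the moments in [t] *)

Section TimeDerivative.
Context (dp dq : {poly R}).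
Hypothesis size_dp : (size dp <= n)%N.
Hypothesis size_dq : (size dq <= n)%N.
(* These come from differentiating [L 0 (p * f) = 0] and
   [L 0 (q * f) = f`_n.-1] in t, since d w/dt = - w / y. *)
Hypothesis L_dp : forall f : {poly R},
  (size f <= n)%N -> L 0 (dp * f) = L 1 (p * f).
Hypothesis L_dq : forall f : {poly R},
  (size f <= n)%N -> L 0 (dq * f) = L 1 (q * f).

Lemma L0_inj (f g : {poly R}) : (size f <= n)%N -> (size g <= n)%N ->
  (forall e : {poly R}, (size e <= n)%N -> L 0 (f * e) = L 0 (g * e)) -> f = g.
Proof.
move=> sf sg fg; apply/eqP; rewrite -subr_eq0; apply/negPn/negP => fg0.
have sfg : (size (f - g)%R <= n)%N.
  by rewrite (leq_trans (size_polyD _ _))// geq_max size_polyN sf.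
suff : 0 < L 0 ((f - g) * (f - g)).
  by rewrite mulrBl linearB/= fg// subrr ltxx.
apply: L0_gt0 => [|y _]; first by rewrite mulf_neq0.
by rewrite hornerM -expr2 sqr_ge0.
Qed.

Lemma split0 (f : {poly R}) m : (size f <= m.+1)%N ->
  exists2 g : {poly R}, f = (f`_0)%:P + 'X * g & (size g <= m)%N.
Proof.
move=> sf; have [|| g [gE sg _]] := @div_polyX (f - (f`_0)%:P) m.
- by rewrite coefB coefC subrr.
- rewrite (leq_trans (size_polyD _ _))// geq_max size_polyN sf.
  by rewrite (leq_trans (size_polyC_leq1 _)).
by exists g => //; rewrite -gE addrC subrK.
Qed.

(** Against [1/y] only the constant term of a test polynomial stays singular; the rest is an
    ordinary integral, accessible to orthogonality. *)
Lemma L1_split (f e : {poly R}) m : (size e <= m.+1)%N ->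
  exists2 g : {poly R}, (size g <= m)%N &
    L 1 (f * e) = e`_0 * L 1 f + L 0 (f * g).
Proof.
move=> /split0[g eE sg]; exists g => //.
by rewrite [in LHS]eE mulrDr linearD/= mulrC mul_polyC linearZ/= mulrCA L_shift.
Qed.

Lemma X_eq : X = p`_0 * L 1 p.
Proof.
rewrite /X; have [g sg ->] := L1_split p (eq_leq size_p).
by rewrite orth_p// addr0.
Qed.

Lemma Z_eq : Z = q`_0 * L 1 q.
Proof.
rewrite /Z; case: (posnP n) => [n0|n0].
  by rewrite q_eq0// mulr0 linear0 coef0 mul0r.
have [|g sg ->] := @L1_split q q n.-1; first by rewrite prednK.
rewrite dual_q; last by rewrite (leq_trans sg)// leq_pred.
by rewrite (coef_ge_size sg) addr0.
Qed.

Lemma Y_eq : Y = q`_0 * L 1 p.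
Proof.
rewrite /Y; case: (posnP n) => [n0|n0].
  by rewrite q_eq0// mulr0 linear0 coef0 mul0r.
have [|g sg ->] := @L1_split p q n.-1; first by rewrite prednK.
by rewrite orth_p ?addr0// (leq_trans sg)// leq_pred.
Qed.

(** Here [p] is expanded instead of [q]: its quotient by [X] has leading coefficient 1, which
    [dual_q] returns. For [n = 0] one has [q = 0] and the extra 1 is absent. *)
Lemma Y_eq1 : (0 < n)%N -> Y = p`_0 * L 1 q + 1.
Proof.
move=> n0; rewrite /Y mulrC; have [g gE sg] := split0 (eq_leq size_p).
rewrite [X in q * X]gE mulrDr linearD/= mulrC mul_polyC linearZ/= mulrCA L_shift dual_q//.
congr (_ + _); have := congr1 (coefp n) gE.
by rewrite /= p_coefn coefD coefC eqn0Ngt n0 add0r coefXM eqn0Ngt n0.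
Qed.

Lemma L1_pe (e : {poly R}) : (size e <= n)%N -> L 1 (p * e) = e`_0 * L 1 p.
Proof.
move=> se; have [|g sg ->] := @L1_split p e n; first exact: leqW.
by rewrite orth_p// addr0.
Qed.

Lemma L1_qe (e : {poly R}) : (size e <= n)%N -> L 1 (q * e) = e`_0 * L 1 q.
Proof.
case: (posnP n) => [n0|n0] se; first by rewrite q_eq0// mul0r !linear0 mulr0.
have [|g sg ->] := @L1_split q e n.-1; first by rewrite prednK.
rewrite dual_q; last by rewrite (leq_trans sg)// leq_pred.
by rewrite (coef_ge_size sg) addr0.
Qed.

(** The condition on [a], [b] makes [a p - b q] vanish at 0, hence equal to [X g]. Then [g] and [d]
    have the same pairings with all polynomials of degree below [n], and positive definiteness
    identifies them. *)
Lemma ladder_comb (a b : R) (d : {poly R}) : a * p`_0 = b * q`_0 ->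
  (size d <= n)%N ->
  (forall e : {poly R}, (size e <= n)%N -> L 0 (d * e) =
     a * L 1 (p * e) - b * L 1 (q * e)) ->
  'X * d = a *: p - b *: q.
Proof.
move=> ab sd dE.
have [|| g [gE sg _]] := @div_polyX (a *: p - b *: q) n.
- by rewrite coefB !coefZ ab subrr.
- rewrite (leq_trans (size_polyD _ _))// geq_max size_polyN.
  by rewrite !(leq_trans (size_scale_leq _ _)) ?size_p// leqW.
rewrite gE; congr (_ * _); apply: L0_inj => // e se; rewrite dE//.
by rewrite -(L_shift 0 (g * e)) mulrA -gE mulrBl -!scalerAl scalar_lincomb.
Qed.

(** Tested on [e], both sides reduce to multiples of [e(0)]; the multiples agree because
    [Y <p/y> - X <q/y> = <p/y>]. *)
Lemma ladder_p : 'X * dp = Y *: p - X *: q.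
Proof.
apply: ladder_comb => //; first by rewrite mulrC kernel0_p mulrC.
move=> e se; rewrite L_dp// L1_pe// L1_qe//.
case: (posnP n) => [n0|n0].
  by rewrite coef_ge_size ?mul0r ?mulr0 ?subrr// (leq_trans se)// n0.
by rewrite [in RHS]Y_eq1// X_eq; ring.
Qed.

Lemma ladder_q : 'X * dq = Z *: p + (1 - Y) *: q.
Proof.
rewrite -[in RHS](opprB Y) scaleNr; apply: ladder_comb => //.
  by rewrite mulrC kernel0_q mulrC.
move=> e se; rewrite L_dq// L1_pe// L1_qe// Z_eq Y_eq; ring.
Qed.

Lemma L0_dp_p : L 0 (dp * p) = 0.
Proof. by rewrite mulrC orth_p. Qed.

Lemma L0_dp_q : L 0 (dp * q) = Y.
Proof. by rewrite L_dp. Qed.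

Lemma L0_p_dq : L 0 (p * dq) = 0.
Proof. by rewrite orth_p. Qed.

Lemma M_mul f g : M (f * g) = M ('X * f * g) + L 0 (f * g).
Proof. by rewrite -mulrA M_shift subrK. Qed.

(** The left sides here and in the next three lemmas are the [t]-derivatives of [h], [X1], [Y1],
    [Y]: the product rule plus a contribution of [dw/dt = - w/y]. For [X1] and [Y1] the latter is
    split by [1/(y(1-y)) = 1/y + 1/(1-y)]. *)
Lemma dh_eq : L 0 (dp * p + p * dp) - L 1 (p * p) = - X.
Proof. by rewrite linearD/= (mulrC dp) orth_p// !add0r. Qed.

Lemma dX1_eq : M (dp * p + p * dp) - (L 1 (p * p) + M (p * p)) =
  2 * (Y * X1 - X * Y1) - X - X1.
Proof.
rewrite (mulrC p dp) linearD/= [M (dp * p)]M_mul L0_dp_p ladder_p mulrBl -!scalerAl.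
by rewrite scalar_lincomb (mulrC q p) -/X -/X1 -/Y1; ring.
Qed.

Lemma dY1_eq : M (dp * q + p * dq) - (L 1 (p * q) + M (p * q)) =
  Z * X1 - X * Z1.
Proof.
rewrite linearD/= [M (dp * q)]M_mul L0_dp_q ladder_p (mulrC p dq).
rewrite [M (dq * p)]M_mul (mulrC dq p) L0_p_dq ladder_q mulrBl mulrDl.
rewrite -!scalerAl scalar_lincomb linearD/= !scalarZ (mulrC q p).
by rewrite -/X -/X1 -/Y1 -/Y -/Z1; ring.
Qed.

Lemma dY_eq : L 1 (dp * q + p * dq) - L 2 (p * q) = Z * X2 - X * Z2.
Proof.
rewrite linearD/= -!(L_shift 1) mulrA ladder_p mulrCA ladder_q.
rewrite mulrBl mulrDr -!scalerAl -!scalerAr scalar_lincomb linearD/= !scalarZ.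
by rewrite -/X2 -/Y2 -/Z2; ring.
Qed.

Lemma functional_riccati : 0 < t -> 0 < alpha -> 0 < beta -> 0 < X ->
  let k := 2 * n%:R + 1 + alpha + beta in
  let r := beta * X1 / h in let A := t * Y in let B := beta * Y1 in
  let dh := L 0 (dp * p + p * dp) - L 1 (p * p) in
  let dX1 := M (dp * p + p * dp) - (L 1 (p * p) + M (p * p)) in
  let dY1 := M (dp * q + p * dq) - (L 1 (p * q) + M (p * q)) in
  let dY := L 1 (dp * q + p * dq) - L 2 (p * q) in
  k < r /\
  [/\ t * (beta * (dX1 * h - X1 * dh) / h ^+ 2) =
        2 * (r * A - (r - k) * B) + (r - beta) * (r - k) - t * r,
      t * (beta * dY1) =
        r * (A * (A - t)) / (r - k) - (r - k) * (B * (B + beta)) / r,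
      t * (Y + t * dY) = A + t * (beta * dY1) &
      (r - k) * (B * (B + beta)) / r + r * (A * (A - t)) / (r - k) =
        (2 * A - t) * (B - n%:R) - alpha * A].
Proof.
move=> t0 a0 b0 X0 k r A B dh dX1 dY1 dY.
have h0 : 0 < h.
  apply: L0_gt0 => [|y _]; first by rewrite mulf_neq0// p_neq0.
  by rewrite hornerM -expr2 sqr_ge0.
have k0 : 0 < k by rewrite /k -!addrA ltr_wpDl ?mulr_ge0 ?addr_gt0.
(* Positivity of [X1] and the bound [k < r] both come from this sum of positive terms. *)
have bX1 : beta * X1 = k * h + t * X by rewrite -ibp_Xpp; ring.
have X10 : 0 < X1 by rewrite -(pmulr_rgt0 _ b0) bX1 addr_gt0// mulr_gt0.
split; first by rewrite /r ltr_pdivlMr// bX1 ltrDl mulr_gt0.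
apply: (@riccati_of_moment_relations _ t alpha beta n%:R h X Y Z X1 Y1 Z1 X2 Y2 Z2);
  rewrite ?gt_eqF//.
- exact: ibp_Xpp.
- exact: ibp_pp.
- exact: ibp_pq.
- exact: ibp_qq.
- exact: quad0.
- exact: quad1.
- exact: quad2.
- exact: dh_eq.
- exact: dX1_eq.
- exact: dY1_eq.
- exact: dY_eq.
Qed.
End TimeDerivative.

End Functionals.

Local Open Scope classical_set_scope.

(** * Integrals against the weight *)

Section Integration.
Context {R : realType}.
Notation mu := (@lebesgue_measure R).

Lemma derivable_is_derive (f : R -> R) (x d : R) :
  is_derive x 1 f d -> derivable f x 1.
Proof. by case. Qed.

Lemma is_derive_congr (f g : R -> R) (x d e : R) : is_derive x 1 f d ->
  f =1 g -> d = e -> is_derive x 1 g e.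
Proof. by move=> df /funext <- <-. Qed.

Lemma continuous_is_derive (f : R -> R) (x d : R) :
  is_derive x 1 f d -> {for x, continuous f}.
Proof.
by case=> df _; apply/differentiable_continuous/derivable1_diffP.
Qed.

Lemma is_derive_onem_powR (c y : R) : y < 1 ->
  is_derive y 1 (fun x => (1 - x) `^ c) (- (c * (1 - y) `^ (c - 1))).
Proof.
move=> y1; have y1' : 0 < 1 - y by rewrite subr_gt0.
have d1 : is_derive y 1 (fun x : R => 1 - x) (0 - 1) by exact: is_deriveB.
have d2 := is_derive1_powR c y1'.
have d3 := @is_derive1_comp _ (fun x => x `^ c) (fun x : R => 1 - x) _ _ _ d2 d1.
apply: is_derive_congr d3 _ _ => //.
by rewrite sub0r mulrN1.
Qed.

Lemma measurable_onem_powR (c : R) (D : set R) :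
  measurable_fun D (fun x => (1 - x) `^ c).
Proof.
apply: (@measurableT_comp _ _ _ _ _ _ (fun x => x `^ c)).
  exact: measurable_powR.
by apply: measurable_funB.
Qed.

(** For [b < 1] the integrand is singular at 1. On [[0, 1 - 1/(n+1)]] the primitive
    [- (1 - x)^b / b] bounds the integral by [1/b], and monotone convergence carries the bound to
    [0, 1]. *)
Lemma integrable_onem_powR (b : R) : 0 < b ->
  mu.-integrable `[0, 1] (EFin \o (fun x => (1 - x) `^ (b - 1))).
Proof.
move=> b0; apply/integrableP; split.
  by apply/measurable_EFinP; exact: measurable_onem_powR.
under eq_integral do rewrite /= ger0_norm ?powR_ge0//.
rewrite -integral_itv_bndo_bndc; last first.
  by apply/measurable_EFinP; exact: measurable_onem_powR.
rewrite itv_bnd_open_bigcup.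
apply: (@le_lt_trans _ _ (b^-1)%:E); last exact: ltry.
have nd : nondecreasing_seq (fun n => `[0, 1 - n.+1%:R^-1]%classic : set R).
  apply/nondecreasing_seqP => n; rewrite subsetEset => x /=.
  rewrite !in_itv/= => /andP[-> /le_trans]; apply.
  by rewrite lerD2l lerN2 lef_pV2 ?posrE ?ltr0n// ler_nat.
have cv := @ge0_nondecreasing_set_cvg_integral _ (measurableTypeR R) R _
  (EFin \o (fun x => (1 - x) `^ (b - 1))) mu nd.
apply: (cvge_le _ (cv _ _ _)); first last.
- by move=> i x _; rewrite lee_fin powR_ge0.
- by move=> i; apply/measurable_EFinP; exact: measurable_onem_powR.
- by move=> i; exact: measurable_itv.
apply: nearW => -[|n].
  (* The first interval of the sequence is the single point 0. *)
  by rewrite invr1 subrr set_itv1 integral_set1 lee_fin invr_ge0 ltW.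
have c0 : 0 < 1 - n.+2%:R^-1 :> R by rewrite subr_gt0 invf_lt1 ?ltr1n ?ltr0n.
have c1 : 1 - n.+2%:R^-1 < 1 :> R by rewrite gtrBl invr_gt0.
rewrite (@continuous_FTC2 _ _ (fun x => - b^-1 * (1 - x) `^ b))//.
- rewrite -EFinB lee_fin subr0 powR1 mulr1 opprK gerDr.
  by rewrite mulNr oppr_le0 mulr_ge0 ?powR_ge0// invr_ge0 ltW.
- apply: continuous_in_subspaceT => x /=.
  rewrite inE/= in_itv/= => /andP[_ /le_lt_trans xc].
  exact/continuous_is_derive/is_derive_onem_powR/(xc _ c1).
- have cF (x : R) : x < 1 -> {for x, continuous (fun x : R => - b^-1 * (1 - x) `^ b)}.
    move=> x1; apply: continuousM; first exact: cst_continuous.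
    exact/continuous_is_derive/is_derive_onem_powR.
  split.
  + move=> x; rewrite in_itv/= => /andP[_ xc].
    apply: derivableM; first exact: derivable_cst.
    exact/derivable_is_derive/is_derive_onem_powR/(lt_trans xc c1).
  + by apply: cvg_at_right_filter; exact: cF.
  + by apply: cvg_at_left_filter; exact: cF.
- move=> x; rewrite in_itv/= => /andP[_ xc].
  have x1 := lt_trans xc c1.
  rewrite derive1E; have [dx dxE] := is_derive_onem_powR b x1.
  rewrite deriveM// derive_cst scaler0 addr0 dxE /GRing.scale/=.
  by rewrite mulrNN mulKf// gt_eqF.
Qed.

Lemma integrable_add d (T : measurableType d) (nu : {measure set T -> \bar R})
    (D : set T) (f g : T -> R) : measurable D ->
  nu.-integrable D (EFin \o f) -> nu.-integrable D (EFin \o g) ->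
  nu.-integrable D (EFin \o (fun x => f x + g x)).
Proof.
move=> mD intf intg.
rewrite (_ : EFin \o _ = (EFin \o f) \+ (EFin \o g))%E//.
exact: integrableD.
Qed.

(** Since [f] need not be continuous at the ends, [F] is compared with the integral of [f] from [a]:
    both are continuous on the closed interval and have equal derivatives inside, so the mean value
    theorem makes their difference constant. *)
Lemma improper_FTC2 (f F : R -> R) (a b : R) : a < b ->
  mu.-integrable `[a, b] (EFin \o f) ->
  (forall x, a < x < b -> is_derive x 1 F (f x)) ->
  (forall x, a < x < b -> {for x, continuous f}) ->
  F @ a^'+ --> F a -> F @ b^'- --> F b ->
  \int[mu]_(x in `[a, b]) f x = F b - F a.
Proof.
move=> ab intf dF cf Fa Fb.
pose G x := parameterized_integral mu a x f.
have cG : {within `[a, b], continuous G}.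
  by apply: parameterized_integral_continuous => //; exact: ltW.
have cF : {within `[a, b], continuous F}.
  apply/(continuous_within_itvP _ ab); split => // x.
  rewrite in_itv/= => /dF; exact: continuous_is_derive.
have dG x : a < x < b -> is_derive x 1 G (f x).
  move=> /andP[ax xb].
  have cx : {for x, continuous f} by apply: cf; rewrite ax xb.
  have [d1 d2] := continuous_FTC1_closed xb intf ax cx.
  by split; [exact: d1|rewrite -derive1E; exact: d2].
have [||c _] := @MVT _ (G - F) (cst 0) a b ab.
- move=> x; rewrite in_itv/= => axb.
  have := dF _ axb; have := dG _ axb => dGx dFx.
  by apply: (is_derive_congr (is_deriveB dGx dFx)) => //; rewrite subrr.
- by move=> x; apply: continuousB; [exact: cG|exact: cF].
rewrite mul0r => /eqP; rewrite subr_eq0 => /eqP.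
rewrite !fctE /G /parameterized_integral set_itv1 Rintegral_set1 => e.
by apply/eqP; rewrite -subr_eq0; apply/eqP; lra.
Qed.

(** * Kernels of the moments: bounds and integrability *)

Variables (alpha beta : R).
Hypotheses (alpha_gt0 : 0 < alpha) (beta_gt0 : 0 < beta).

Definition kern (k b : nat) (t y : R) : R :=
  weight alpha beta t y / y ^+ k / (1 - y) ^+ b.

Definition moment (k b : nat) (t : R) (f : {poly R}) : R :=
  int01 (fun y => f.[y] * kern k b t y).

Lemma weight0 t : weight alpha beta t 0 = 0.
Proof. by rewrite /weight powR0 ?mulr0 ?mul0r// gt_eqF. Qed.

Lemma weight1 t : weight alpha beta t 1 = 0.
Proof. by rewrite /weight subrr powR0 ?mulr0// gt_eqF. Qed.

Lemma weight_ge0 t y : 0 <= weight alpha beta t y.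
Proof. by rewrite /weight !mulr_ge0 ?expR_ge0 ?powR_ge0. Qed.

Lemma weight_gt0 t y : 0 < y < 1 -> 0 < weight alpha beta t y.
Proof.
by move=> /andP[y0 y1]; rewrite /weight !mulr_gt0 ?expR_gt0 ?powR_gt0 ?subr_gt0.
Qed.

Lemma kern_ge0 k b t y : 0 <= y <= 1 -> 0 <= kern k b t y.
Proof.
move=> /andP[y0 y1].
by rewrite /kern !divr_ge0 ?weight_ge0 ?exprn_ge0 ?subr_ge0.
Qed.

Lemma kern_gt0 k b t y : 0 < y < 1 -> 0 < kern k b t y.
Proof.
move=> /[dup] /andP[y0 y1] y01.
by rewrite /kern !divr_gt0 ?weight_gt0 ?exprn_gt0 ?subr_gt0.
Qed.

(** From [z^k / k! <= exp z] at [z = x/y]. This is why negative powers of [y] do no harm near 0. *)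
Lemma expRN_div_le (k : nat) (x y : R) : 0 < x -> 0 < y ->
  expR (- x / y) / y ^+ k <= k`!%:R / x ^+ k.
Proof.
move=> x0 y0; have xy0 : 0 < x / y by rewrite divr_gt0.
rewrite mulNr expRN ler_pdivrMr ?exprn_gt0// mulrAC ler_pdivlMr ?exprn_gt0//.
rewrite -ler_pdivrMl ?ltr0n ?fact_gt0// mulrC -mulrA.
rewrite ler_pdivrMl ?expR_gt0// -ler_pdivrMr ?exprn_gt0// mulrAC -expr_div_n.
case: k => [|k].
  by rewrite expr0 fact0 divr1 (le_trans _ (expR_ge1Dx _))// lerDl ltW.
by apply: le_trans (expR_ge1Dxn k (ltW xy0)); rewrite ler_wpDl.
Qed.

(** The weight vanishes at both endpoints because the exponents are positive, so [kernX] and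
    [kern_onem] hold there too, despite the division by zero. *)
Lemma kern_endpoint k b t (y : R) : y = 0 \/ y = 1 -> kern k b t y = 0.
Proof. by case=> ->; rewrite /kern ?weight0 ?weight1 !mul0r. Qed.

Lemma powR_onem_div b (y : R) : (b <= 1)%N -> 0 < y < 1 ->
  (1 - y) `^ beta / (1 - y) ^+ b <= (1 - y) `^ (beta - 1).
Proof.
move=> b1 /andP[y0 y1]; have y1' : 0 < 1 - y by rewrite subr_gt0.
rewrite ler_pdivrMr ?exprn_gt0//; move: b b1 => [|[|//]] _.
  by rewrite expr0 mulr1 ger_powR ?y1'/=; lra.
by rewrite expr1 mulrC mulr_powRB1// ltW.
Qed.

(** The exponential at the smaller parameter [s] absorbs the power of [y], so the bound is uniform
    in [t >= s], as domination under the integral sign requires. With [b <= 1] the singularity at 1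
    stays integrable. *)
Lemma kern_le k b s t (y : R) : (b <= 1)%N -> 0 < s -> s <= t -> 0 <= y <= 1 ->
  kern k b t y <= k`!%:R / s ^+ k * (1 - y) `^ (beta - 1).
Proof.
move=> b1 s0 st /andP[y0 y1].
have [->|yN0] := eqVneq y 0.
  rewrite kern_endpoint; last by left.
  by rewrite mulr_ge0 ?powR_ge0// divr_ge0 ?ler0n// exprn_ge0// ltW.
have [->|yN1] := eqVneq y 1.
  rewrite kern_endpoint; last by right.
  by rewrite mulr_ge0 ?powR_ge0// divr_ge0 ?ler0n// exprn_ge0// ltW.
have {yN0}y0 : 0 < y by rewrite lt_def yN0.
have {yN1}y1 : y < 1 by rewrite lt_def eq_sym yN1.
rewrite (_ : kern _ _ _ _ = (expR (- t / y) / y ^+ k) * y `^ alpha *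
    ((1 - y) `^ beta / (1 - y) ^+ b)); last by rewrite /kern /weight; ring.
apply: ler_pM.
- by rewrite !mulr_ge0 ?expR_ge0 ?powR_ge0// invr_ge0 exprn_ge0// ltW.
- by rewrite divr_ge0 ?powR_ge0// exprn_ge0// subr_ge0 ltW.
- rewrite -[leRHS]mulr1 ler_pM ?powR_ge0//.
  + by rewrite divr_ge0 ?expR_ge0// exprn_ge0// ltW.
  + apply: le_trans (expRN_div_le k s0 y0).
    rewrite ler_pM2r ?invr_gt0 ?exprn_gt0// ler_expR ler_pM2r ?invr_gt0//.
    by rewrite lerN2.
  + rewrite -[leRHS](powRr0 y); apply: ger_powR; last exact: ltW.
    by rewrite y0 ltW.
- by apply: powR_onem_div => //; rewrite y0 y1.
Qed.

Lemma is_derive_weight t (y : R) : 0 < y < 1 ->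
  is_derive y 1 (weight alpha beta t)
    (weight alpha beta t y * (t / y ^+ 2 + alpha / y - beta / (1 - y))).
Proof.
move=> /andP[y0 y1]; have y1' : 0 < 1 - y by rewrite subr_gt0.
have yN0 : y != 0 by rewrite gt_eqF.
have dV : is_derive y 1 (fun x : R => - t * x^-1) (- t * (- y ^- 2)).
  have dinv := @is_deriveV _ id y _ _ yN0 (is_derive_id y 1).
  apply: is_derive_congr (is_deriveZ (- t) dinv) _ _ => //.
  by rewrite /GRing.scale/= mulr1.
have dE := @is_derive1_comp _ expR (fun x : R => - t * x^-1) _ _ _ (is_derive_expR _) dV.
have dA := is_derive1_powR alpha y0.
have dB := is_derive_onem_powR beta y1.
have d := is_deriveM (is_deriveM dE dA) dB.
apply: is_derive_congr d _ _ => //.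
rewrite /weight /GRing.scale/= !fctE/=.
have -> : y `^ alpha = y * y `^ (alpha - 1) by rewrite mulr_powRB1// ltW.
have -> : (1 - y) `^ beta = (1 - y) * (1 - y) `^ (beta - 1).
  by rewrite mulr_powRB1// ltW.
by field; rewrite yN0 gt_eqF.
Qed.

Lemma continuous_kern k b t (f : {poly R}) (y : R) : 0 < y < 1 ->
  {for y, continuous (fun y => f.[y] * kern k b t y)}.
Proof.
move=> y01; have /andP[y0 y1] := y01.
apply: continuousM; first exact: continuous_horner.
apply: continuousM.
  apply: continuousM.
    exact: continuous_is_derive (is_derive_weight t y01).
  apply: continuousV; first by rewrite expf_neq0// gt_eqF.
  exact: exprn_continuous.
apply: continuousV; first by rewrite expf_neq0// gt_eqF// subr_gt0.
exact: continuous_onemXn.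
Qed.

Lemma measurable_kern k b t (f : {poly R}) :
  measurable_fun (`[0, 1] : set R) (fun y => f.[y] * kern k b t y).
Proof.
(* The flags select the open interval, where the integrand is continuous; the endpoints do not
   affect measurability. *)
apply: (@measurable_fun_itv_cc _ 0 1 false true).
apply: open_continuous_measurable_fun => // y.
by rewrite inE/= in_itv/=; exact: continuous_kern.
Qed.

Lemma horner_bound (f : {poly R}) :
  exists2 C, 0 <= C & forall y, 0 <= y <= 1 -> `|f.[y]| <= C.
Proof.
exists (\sum_(i < size f) `|f`_i|); first by rewrite sumr_ge0.
move=> y /andP[y0 y1]; rewrite horner_coef (le_trans (ler_norm_sum _ _ _))//.
apply: ler_sum => i _; rewrite normrM ler_piMr// normrX exprn_ile1//.
by rewrite ger0_norm.
Qed.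

Lemma normr_kern_le k b s (f : {poly R}) : (b <= 1)%N -> 0 < s ->
  exists2 C, 0 <= C & forall t y, s <= t -> 0 <= y <= 1 ->
    `|f.[y] * kern k b t y| <= C * (1 - y) `^ (beta - 1).
Proof.
move=> b1 s0; have [C C0 fC] := horner_bound f.
exists (C * (k`!%:R / s ^+ k)).
  by rewrite mulr_ge0// divr_ge0 ?ler0n// exprn_ge0// ltW.
move=> t y st y01; rewrite normrM (ger0_norm (kern_ge0 _ _ _ y01)) -mulrA.
by rewrite ler_pM ?kern_ge0 ?fC ?kern_le.
Qed.

Lemma integrable_kern k b t (f : {poly R}) : (b <= 1)%N -> 0 < t ->
  mu.-integrable `[0, 1] (EFin \o (fun y => f.[y] * kern k b t y)).
Proof.
move=> b1 t0; have [C C0 CP] := normr_kern_le k f b1 t0.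
apply: (@le_integrable _ (measurableTypeR R) R _ _ _ _
  (EFin \o (fun y => C * (1 - y) `^ (beta - 1)))) => //.
- by apply/measurable_EFinP; exact: measurable_kern.
- move=> y /=; rewrite in_itv/= => y01; rewrite lee_fin [leRHS]ger0_norm ?CP//.
  by rewrite mulr_ge0 ?powR_ge0.
- exact: integrableZl (integrable_onem_powR beta_gt0).
Qed.

(** * Moments: linearity, shifts, derivative in [t], positivity *)

Lemma moment_lincomb k b (t a : R) (f g : {poly R}) : (b <= 1)%N -> 0 < t ->
  moment k b t (a *: f + g) = a * moment k b t f + moment k b t g.
Proof.
move=> b1 t0; rewrite /moment /int01 -RintegralZl//; last exact: integrable_kern.
rewrite -RintegralD//; last 2 first.
- have iZ : mu.-integrable `[0, 1] (EFin \o (fun y : R => a * (f.[y] * kern k b t y))).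
    exact: (integrableZl _ a (integrable_kern k f b1 t0)).
  exact: iZ.
- exact: integrable_kern.
have e (y : R) : (a *: f + g).[y] * kern k b t y =
    a * (f.[y] * kern k b t y) + g.[y] * kern k b t y.
  by move: (kern k b t y) => K; rewrite hornerD hornerZ mulrDl mulrA.
by apply: eq_Rintegral => y _; exact: e.
Qed.

Lemma kernX k b t (y : R) : y * kern k.+1 b t y = kern k b t y.
Proof.
have [->|y0] := eqVneq y 0; first by rewrite !kern_endpoint ?mulr0//; left.
rewrite /kern exprS invfM.
by move: (y ^+ k)^-1 ((1 - y) ^+ b)^-1 => u v; field.
Qed.

Lemma kern_onem k t (y : R) : (1 - y) * kern k 1 t y = kern k 0 t y.
Proof.
have [->|y1] := eqVneq y 1; first by rewrite !kern_endpoint ?mulr0//; right.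
have y1' : 1 - y != 0 by rewrite subr_eq0 eq_sym.
by rewrite /kern expr1 expr0 invr1 mulr1 mulrC divfK.
Qed.

Lemma momentX k b t (f : {poly R}) : moment k.+1 b t ('X * f) = moment k b t f.
Proof.
have e (y : R) : ('X * f).[y] * kern k.+1 b t y = f.[y] * kern k b t y.
  by rewrite -(kernX k b) hornerM hornerX; move: (kern _ _ _ _) => K; ring.
by apply: eq_Rintegral => y _; exact: e.
Qed.

Lemma moment_onem k t (f : {poly R}) :
  moment k 1 t ((1 - 'X) * f) = moment k 0 t f.
Proof.
have e (y : R) : ((1 - 'X) * f).[y] * kern k 1 t y = f.[y] * kern k 0 t y.
  rewrite -kern_onem hornerM hornerD hornerN hornerX hornerC.
  by move: (kern _ _ _ _) => K; ring.
by apply: eq_Rintegral => y _; exact: e.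
Qed.

Lemma is_derive_kern k b (t y : R) :
  is_derive t 1 (fun s => kern k b s y) (- kern k.+1 b t y).
Proof.
have dV : is_derive t 1 (fun s : R => - y^-1 * s) (- y^-1 * 1).
  exact: is_deriveZ.
have dE := @is_derive1_comp _ expR (fun s : R => - y^-1 * s) _ _ _ (is_derive_expR _) dV.
have d := is_deriveZ (y `^ alpha * (1 - y) `^ beta / y ^+ k / (1 - y) ^+ b) dE.
apply: is_derive_congr d _ _ => [s|].
  by rewrite /= /GRing.scale/= /kern /weight mulNr [_^-1 * s]mulrC -mulNr; ring.
rewrite /GRing.scale/= /kern /weight mulNr [_^-1 * t]mulrC -[- (t / y)]mulNr exprS invfM.
by ring.
Qed.

Lemma is_derive_moment k b (t : R) (f : {poly R}) : (b <= 1)%N -> 0 < t ->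
  is_derive t 1 (fun s => moment k b s f) (- moment k.+1 b t f).
Proof.
move=> b1 t0.
(* The neighbourhood []t/2, t + 1[] keeps the parameter away from 0, so one dominating function
   serves all of it. *)
have t20 : 0 < t / 2 by rewrite divr_gt0.
have [C C0 CP] := normr_kern_le k.+1 f b1 t20.
have It : `]t / 2, t + 1[%classic t by rewrite /= in_itv/=; apply/andP; split; lra.
have d (x y : R) : is_derive x 1 (fun s => f.[y] * kern k b s y)
    (- (f.[y] * kern k.+1 b x y)).
  apply: is_derive_congr (is_deriveZ f.[y] (is_derive_kern k b x y)) _ _ => //.
  by rewrite /GRing.scale/= mulrN.
have intf (x : R) : `]t / 2, t + 1[%classic x ->
    mu.-integrable `[0, 1] (EFin \o (fun y => f.[y] * kern k b x y)).
  rewrite /= in_itv/= => /andP[x0 _].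
  by apply: integrable_kern => //; exact: lt_trans x0.
have derf (x y : R) : `]t / 2, t + 1[%classic x -> `[0, 1]%classic y ->
    derivable (fun x => f.[y] * kern k b x y) x 1.
  by move=> _ _; exact: derivable_is_derive (d x y).
have G0 (y : R) : 0 <= C * (1 - y) `^ (beta - 1) by rewrite mulr_ge0 ?powR_ge0.
have intG : mu.-integrable `[0, 1] (EFin \o (fun y => C * (1 - y) `^ (beta - 1))).
  exact: integrableZl (integrable_onem_powR beta_gt0).
have dE (x y : R) : partial1of2 (fun s y => f.[y] * kern k b s y) x y =
    - (f.[y] * kern k.+1 b x y).
  by rewrite partial1of2E; have [_ ->] := d x y.
have Gub (x y : R) : `]t / 2, t + 1[%classic x -> `[0, 1]%classic y ->
    `|partial1of2 (fun s y => f.[y] * kern k b s y) x y| <= C * (1 - y) `^ (beta - 1).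
  rewrite /= !in_itv/= => /andP[x0 _] y01; rewrite dE normrN; apply: CP => //.
  exact: ltW.
have mI : measurable (`[0, 1]%classic : set (measurableTypeR R)) by exact: measurable_itv.
split.
  exact: (derivable_under_integral mI It intf derf G0 intG Gub).
rewrite -derive1E.
have := differentiation_under_integral mI It intf derf G0 intG Gub.
rewrite /moment /int01 => ->.
under eq_Rintegral do rewrite dE -mulN1r.
by rewrite RintegralZl ?mulN1r//; exact: integrable_kern.
Qed.

(* If the integral vanished, so would its primitive on [0, 1], hence the
   integrand on ]0, 1[, and f would have infinitely many roots. *)
Lemma moment_gt0 k b t (f : {poly R}) : (b <= 1)%N -> 0 < t -> f != 0 ->
  (forall y, 0 <= y <= 1 -> 0 <= f.[y]) -> 0 < moment k b t f.
Proof.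
move=> b1 t0 f0 fpos.
pose g (y : R) := f.[y] * kern k b t y.
have g0 (y : R) : 0 <= y <= 1 -> 0 <= g y.
  by move=> y01; rewrite mulr_ge0 ?fpos ?kern_ge0.
have intg : mu.-integrable `[0, 1] (EFin \o g) by exact: integrable_kern.
rewrite lt_def; apply/andP; split; last first.
  by apply: Rintegral_ge0 => y /=; rewrite in_itv/=; exact: g0.
apply/negP => /eqP int0.
have G0 (x : R) : 0 <= x <= 1 -> \int[mu]_(y in `[0, x]) g y = 0.
  move=> /andP[x0 x1].
  have sub : `[0, x]%classic `<=` `[0, 1]%classic.
    by move=> y /=; rewrite !in_itv/= => /andP[-> /le_trans]; exact.
  apply/eqP; rewrite eq_le; apply/andP; split; last first.
    apply: Rintegral_ge0 => y /= y0x; apply: g0.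
    by have := sub _ y0x; rewrite /= in_itv.
  rewrite -[leRHS]int0 /moment /int01 fine_le//.
  - by apply: integrable_fin_num => //; exact: integrableS intg.
  - exact: integrable_fin_num.
  - apply: ge0_subset_integral => //.
    by case/integrableP : intg.
have f_root (x : R) : 0 < x < 1 -> f.[x] = 0.
  move=> /andP[x0 x1].
  have x01 : 0 < x < 1 by rewrite x0.
  have cx : {for x, continuous g} by exact: continuous_kern.
  have [_] := continuous_FTC1_closed x1 intg x0 cx.
  rewrite derive1E (@near_eq_derive _ _ _ _ (cst 0)).
    rewrite derive_cst => /esym/eqP; rewrite mulf_eq0 => /orP[/eqP//|].
    by rewrite gt_eqF// kern_gt0.
  have xI : x \in `]0, 1[%R by rewrite in_itv/= x0.
  near=> z; apply: G0.
  have : z \in `]0, 1[%R by near: z; exact: near_in_itvoo.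
  by rewrite in_itv/= => /andP[/ltW -> /ltW ->].
pose rs := [seq i.+2%:R^-1 | i <- iota 0 (size f)] : seq R.
have : (size rs < size f)%N.
  apply: max_poly_roots => //.
    apply/allP => _ /mapP[i _ ->]; apply/rootP/f_root.
    by rewrite invr_gt0 ltr0n/= invf_lt1 ?ltr1n ?ltr0n.
  rewrite map_inj_uniq ?iota_uniq// => i j /invr_inj/eqP.
  by rewrite eqr_nat => /eqP[].
by rewrite size_map size_iota ltnn.
Unshelve. all: by end_near. Qed.

(** * Boundary limits and the Pearson identity *)

Lemma weight_cvg0 (t : R) (f : {poly R}) : 0 < t ->
  (fun y => f.[y] * weight alpha beta t y) @ (0 : R)^'+ --> (0 : R).
Proof.
move=> t0; rewrite -[X in _ --> X](mulr0 f.[0]); apply: cvgM.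
  by apply: cvg_at_right_filter; exact: continuous_horner.
(* The majorant [y / t] is [expRN_div_le] with exponent 1; the two real powers are at most 1. *)
apply: (@squeeze_cvgr _ _ _ _ (cst 0) (fun y => y / t)); last 2 first.
- exact: cvg_cst.
- rewrite -[X in _ --> X](mul0r t^-1); apply: cvgM; last exact: cvg_cst.
  by apply: cvg_at_right_filter; exact: cvg_id.
near=> y; rewrite /= weight_ge0/=.
have y0 : 0 < y by [].
have y1 : y < 1 by near: y; exact: nbhs_right_lt.
have yt : 0 <= y / t by rewrite divr_ge0// ltW.
rewrite /weight -mulrA -[leRHS]mulr1 ler_pM ?expR_ge0 ?mulr_ge0 ?powR_ge0//.
  have := expRN_div_le 1 t0 y0.
  by rewrite !expr1 ler_pdivrMr// [X in _ <= X]mulrAC mul1r.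
rewrite -[leRHS]mulr1 ler_pM ?powR_ge0//.
  rewrite -[leRHS](powRr0 y); apply: ger_powR; last exact: ltW.
  by rewrite y0 ltW.
rewrite -[leRHS](powRr0 (1 - y)); apply: ger_powR; last exact: ltW.
by rewrite subr_gt0 y1 gerBl ltW.
Unshelve. all: by end_near. Qed.

Lemma weight_cvg1 (t : R) (f : {poly R}) : 0 < t ->
  (fun y => f.[y] * weight alpha beta t y) @ (1 : R)^'- --> (0 : R).
Proof.
move=> t0.
rewrite -[X in _ --> X](mulr0 (f.[1] * (expR (- t / 1) * 1 `^ alpha))).
under eq_fun do rewrite /weight mulrA.
apply: cvgM.
  apply: cvg_at_left_filter; apply: cvgM; first exact: continuous_horner.
  apply: cvgM; last first.
    exact: (continuous_is_derive (is_derive1_powR alpha ltr01)).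
  apply: (@cvg_comp _ _ _ (fun y : R => - t / y) expR); last exact: continuous_expR.
  apply: cvgM; first exact: cvg_cst.
  by apply: cvgV => //; exact: cvg_id.
apply: (@cvg_comp _ _ _ (fun y : R => 1 - y) (fun x => x `^ beta) _ 0^'+).
  move=> A [e /= e0 eA]; exists e => // y /= ye y1; apply: eA => /=.
    by rewrite sub0r normrN.
  by rewrite subr_gt0.
exact: powR_cvg0.
Qed.

Lemma moment_ibp (t : R) (f : {poly R}) : 0 < t ->
  moment 0 0 t f^`() + alpha * moment 1 0 t f + t * moment 2 0 t f
    - beta * moment 0 1 t f = 0.
Proof.
move=> t0.
have ik k b g : (b <= 1)%N ->
    mu.-integrable `[0, 1] (EFin \o (fun y => g.[y] * kern k b t y)).
  by move=> b1; exact: integrable_kern.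
pose g1 (y : R) := f^`().[y] * kern 0 0 t y.
pose g2 (y : R) := (alpha *: f).[y] * kern 1 0 t y.
pose g3 (y : R) := (t *: f).[y] * kern 2 0 t y.
pose g4 (y : R) := (- beta *: f).[y] * kern 0 1 t y.
have i12 : mu.-integrable `[0, 1] (EFin \o (fun y => g1 y + g2 y)).
  apply: integrable_add; [exact: measurable_itv|exact: ik|exact: ik].
have i123 : mu.-integrable `[0, 1] (EFin \o (fun y => g1 y + g2 y + g3 y)).
  apply: integrable_add; [exact: measurable_itv|exact: i12|exact: ik].
have i1234 : mu.-integrable `[0, 1] (EFin \o (fun y => g1 y + g2 y + g3 y + g4 y)).
  apply: integrable_add; [exact: measurable_itv|exact: i123|exact: ik].
have momentZ k b a : (b <= 1)%N -> moment k b t (a *: f) = a * moment k b t f.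
  move=> b1; rewrite -[a *: f]addr0 moment_lincomb//.
  (* At the zero polynomial linearity reads [m = m + m], so that moment is 0. *)
  have := @moment_lincomb k b t 1 0 0 b1 t0; rewrite scaler0 addr0 mul1r.
  by move/eqP; rewrite -subr_eq subrr => /eqP <-; rewrite addr0.
rewrite -mulNr -!momentZ//.
transitivity (\int[mu]_(y in `[0, 1]) (g1 y + g2 y + g3 y + g4 y)).
  rewrite RintegralD//; last exact: ik.
  rewrite RintegralD//; last exact: ik.
  by rewrite RintegralD//; exact: ik.
have dF (y : R) : 0 < y < 1 ->
    is_derive y 1 (fun y => f.[y] * weight alpha beta t y)
      (g1 y + g2 y + g3 y + g4 y).
  move=> y01; have d := is_deriveM (is_derive_poly f y) (is_derive_weight t y01).
  apply: is_derive_congr d _ _ => //.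
  rewrite /g1 /g2 /g3 /g4 /kern /GRing.scale/= !hornerZ.
  have /andP[y0 y1] := y01.
  by field; rewrite !gt_eqF// subr_gt0.
have cf (y : R) : 0 < y < 1 ->
    {for y, continuous (fun y => g1 y + g2 y + g3 y + g4 y)}.
  move=> y01; rewrite /continuous_at.
  by do 3![apply: continuousD; last exact: continuous_kern]; exact: continuous_kern.
rewrite (improper_FTC2 ltr01 i1234 dF cf) ?weight0 ?weight1 ?mulr0 ?subrr//.
- exact: weight_cvg0.
- exact: weight_cvg1.
Qed.

End Integration.

(** * Dependence on the parameter *)

(** The system is meant for [r = R_n], [A = t <pq/y>], [B = beta <pq/(1-y)>]. For positive [k], the
    bound [k < r t] keeps its denominators nonzero. *)
Definition riccati_at (R : realType) (alpha beta n : R) (r A B : R -> R)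
    (t : R) : Prop :=
  let k := 2 * n + 1 + alpha + beta in
  exists dr dA dB : R,
  [/\ [/\ is_derive t 1 r dr, is_derive t 1 A dA & is_derive t 1 B dB],
    k < r t,
    t * dr = 2 * (r t * A t - (r t - k) * B t) + (r t - beta) * (r t - k)
      - t * r t,
    t * dB = r t * (A t * (A t - t)) / (r t - k)
      - (r t - k) * (B t * (B t + beta)) / r t &
    t * dA = A t + t * dB /\
    (r t - k) * (B t * (B t + beta)) / r t + r t * (A t * (A t - t)) / (r t - k)
      = (2 * A t - t) * (B t - n) - alpha * A t].

Section PolyPath.
Context {R : realType}.
Implicit Types (u v : R -> {poly R}) (t : R).

(** Differentiation is coefficientwise; the local bound on the size turns moments along the path
    into sums of fixed length. *)
Definition poly_derive u t (du : {poly R}) :=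
  (exists N, \forall s \near t, (size (u s) <= N)%N) /\
  forall i, is_derive t 1 (fun s => (u s)`_i) du`_i.

Lemma is_derive_near_cst (f : R -> R) t (c d : R) :
  (\forall s \near t, f s = c) -> is_derive t 1 f d -> d = 0.
Proof.
move=> fc df; have [_ <-] := near_eq_is_derive fc df.
exact: derive_cst.
Qed.

Lemma poly_derive_size u t du N :
  (\forall s \near t, (size (u s) <= N)%N) -> poly_derive u t du ->
  (size du <= N)%N.
Proof.
move=> uN [_ dudu]; apply/leq_sizeP => i Ni.
apply: (@is_derive_near_cst (fun s => (u s)`_i) t 0 _ _ (dudu i)).
by near=> s; rewrite nth_default// (leq_trans _ Ni)// (near uN s).
Unshelve. all: by end_near. Qed.

Lemma poly_derive_near u v t du : (\forall s \near t, u s = v s) ->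
  poly_derive u t du -> poly_derive v t du.
Proof.
move=> uv [[N uN] du_]; split.
  by exists N; near=> s; rewrite -(near uv s)//; near: s.
move=> i; apply: near_eq_is_derive (du_ i).
by near=> s; rewrite (near uv s).
Unshelve. all: by end_near. Qed.

Lemma poly_derive_cst (c : {poly R}) t : poly_derive (fun=> c) t 0.
Proof.
split; first by exists (size c); near=> s.
by move=> i; rewrite coef0; exact: is_derive_cst.
Unshelve. all: by end_near. Qed.

Lemma poly_deriveD u v t du dv : poly_derive u t du -> poly_derive v t dv ->
  poly_derive (fun s => u s + v s) t (du + dv).
Proof.
move=> [[N uN] du_] [[N' vN] dv_]; split.
  exists (maxn N N'); near=> s; rewrite (leq_trans (size_polyD _ _))//.
  by rewrite geq_max !leq_max (near uN s)// (near vN s)// orbT.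
move=> i; rewrite coefD.
by apply: is_derive_congr (is_deriveD (du_ i) (dv_ i)) _ _ => // s; rewrite coefD.
Unshelve. all: by end_near. Qed.

Lemma poly_derive_sum (I : Type) (r : seq I) (u : I -> R -> {poly R}) t
    (du : I -> {poly R}) : (forall i, poly_derive (u i) t (du i)) ->
  poly_derive (fun s => \sum_(i <- r) u i s) t (\sum_(i <- r) du i).
Proof.
move=> ud; elim: r => [|i r IH].
  rewrite big_nil; apply: poly_derive_near (poly_derive_cst 0 t).
  by near=> s; rewrite big_nil.
rewrite big_cons; apply: poly_derive_near (poly_deriveD (ud i) IH).
by near=> s; rewrite big_cons.
Unshelve. all: by end_near. Qed.

Lemma is_derive_bigsum (I : Type) (r : seq I) (f : I -> R -> R) t
    (df : I -> R) : (forall i, is_derive t 1 (f i) (df i)) ->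
  is_derive t 1 (fun s => \sum_(i <- r) f i s) (\sum_(i <- r) df i).
Proof.
move=> fd; elim: r => [|i r IH].
  rewrite big_nil; apply: is_derive_congr (is_derive_cst (0 : R) t 1) _ _ => //.
  by move=> s; rewrite big_nil.
rewrite big_cons; apply: is_derive_congr (is_deriveD (fd i) IH) _ _ => //.
by move=> s; rewrite big_cons.
Qed.

Lemma is_deriveMR (f g : R -> R) t df dg : is_derive t 1 f df ->
  is_derive t 1 g dg -> is_derive t 1 (fun s => f s * g s) (df * g t + f t * dg).
Proof.
move=> fd gd; apply: is_derive_congr (is_deriveM fd gd) _ _ => //.
by rewrite /GRing.scale/= addrC (mulrC (g t)).
Qed.

Lemma poly_deriveM u v t du dv : poly_derive u t du -> poly_derive v t dv ->
  poly_derive (fun s => u s * v s) t (du * v t + u t * dv).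
Proof.
move=> [[N uN] du_] [[N' vN] dv_]; split.
  exists (N + N')%N; near=> s; rewrite (leq_trans (size_polyMleq _ _))//.
  by rewrite (leq_trans (leq_pred _))// leq_add// ?(near uN s)// (near vN s).
move=> i; rewrite coefD !coefM -big_split/=.
have := is_derive_bigsum (index_enum 'I_i.+1)
  (fun j : 'I_i.+1 => is_deriveMR (du_ j) (dv_ (i - j)%N)).
by move=> h; apply: is_derive_congr h _ _ => // s; rewrite coefM.
Unshelve. all: by end_near. Qed.

Lemma poly_deriveZ (a : R -> R) v t da dv : is_derive t 1 a da ->
  poly_derive v t dv ->
  poly_derive (fun s => a s *: v s) t (da *: v t + a t *: dv).
Proof.
move=> ad [[N vN] dv_]; split.
  exists N; near=> s; rewrite (leq_trans (size_scale_leq _ _))//.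
  by rewrite (near vN s).
move=> i; rewrite coefD !coefZ.
by apply: is_derive_congr (is_deriveMR ad (dv_ i)) _ _ => // s; rewrite coefZ.
Unshelve. all: by end_near. Qed.

Variables (alpha beta : R).
Hypotheses (alpha_gt0 : 0 < alpha) (beta_gt0 : 0 < beta).
Notation moment := (moment alpha beta).

(** Linearity depends on convergence, hence on [t > 0] and [b <= 1], so the linear form is packed
    separately for each parameter. *)
Lemma moment_linear k b t : (b <= 1)%N -> 0 < t ->
  exists L : {scalar {poly R}}, forall f, L f = moment k b t f.
Proof.
move=> b1 t0; pose L := moment k b t : {poly R} -> R.
pose linL := GRing.isLinear.Build R {poly R} R *%R L
  (fun a f g => moment_lincomb alpha_gt0 beta_gt0 k a f g b1 t0).
by exists (HB.pack_for {scalar {poly R}} L linL).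
Qed.

Lemma poly_expand (f : {poly R}) N : (size f <= N)%N ->
  f = \sum_(i < N) f`_i *: 'X^i.
Proof.
move=> sf; rewrite -poly_def; apply/polyP => i; rewrite coef_poly.
by case: ltnP => // Ni; rewrite nth_default// (leq_trans sf).
Qed.

(** Expansion in monomials reduces this to the product rule for a finite sum: the coefficients give
    the first term, the weight the second. *)
Lemma is_derive_moment_path k b u t du : (b <= 1)%N -> 0 < t ->
  poly_derive u t du ->
  is_derive t 1 (fun s => moment k b s (u s))
    (moment k b t du - moment k.+1 b t (u t)).
Proof.
move=> b1 t0 ud; have [[N uN] du_] := ud.
have expand s l (f : {poly R}) : 0 < s -> (size f <= N)%N ->
    moment l b s f = \sum_(i < N) f`_i * moment l b s 'X^i.
  move=> s0 sf; have [L LE] := moment_linear l b1 s0.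
  rewrite -LE [in LHS](poly_expand sf) linear_sum/=.
  by apply: eq_bigr => i _; rewrite linearZ/= LE.
have d := is_derive_bigsum (index_enum 'I_N) (fun i : 'I_N =>
  is_deriveMR (du_ i) (is_derive_moment alpha_gt0 beta_gt0 k 'X^i b1 t0)).
apply: (@near_eq_is_derive _ _ _ (fun s => \sum_(i < N) (u s)`_i * moment k b s 'X^i)).
  near=> s; rewrite expand//; last by rewrite (near uN s).
  by near: s; exact: lt_nbhsr.
apply: is_derive_congr d _ _ => //.
rewrite !(expand t)//; last 2 first.
- exact: nbhs_singleton uN.
- exact: poly_derive_size uN ud.
rewrite -sumrN -big_split/=; apply: eq_bigr => i _.
by rewrite mulrN.
Unshelve. all: by end_near. Qed.

(** * Orthogonal polynomials at a fixed parameter *)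

Section Orthogonal.
Variables (P : nat -> {poly R}) (t : R).
Hypothesis t_gt0 : 0 < t.
Hypothesis P_orth : monic_orthogonal_polynomials (weight alpha beta t) P.

Lemma moment00 f : moment 0 0 t f =
  int01 (fun y => f.[y] * weight alpha beta t y).
Proof.
by apply: eq_Rintegral => y _; rewrite /kern !expr0 !invr1 !mulr1.
Qed.

Lemma P_monic n : P n \is monic. Proof. by case: P_orth. Qed.

Lemma P_size n : size (P n) = n.+1. Proof. by case: P_orth. Qed.

Lemma P_coefn n : (P n)`_n = 1.
Proof. by have /eqP := P_monic n; rewrite /lead_coef P_size. Qed.

Lemma P_orth_neq m n : m != n -> moment 0 0 t (P m * P n) = 0.
Proof.
case: P_orth => _ _ + mn => /(_ _ _ mn) <-; rewrite moment00.
by apply: eq_Rintegral => y _; rewrite hornerM.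
Qed.

Lemma size_sub_lead (f : {poly R}) m : (size f <= m.+1)%N ->
  (size (f - f`_m *: P m)%R <= m)%N.
Proof.
move=> sf; apply/leq_sizeP => i; rewrite leq_eqVlt => /predU1P[<-|mi].
  by rewrite coefB coefZ P_coefn mulr1 subrr.
have Pi : (P m)`_i = 0 by rewrite nth_default ?P_size.
by rewrite coefB coefZ Pi mulr0 subr0 nth_default// (leq_trans sf).
Qed.

Lemma P_orth_size n (f : {poly R}) : (size f <= n)%N ->
  moment 0 0 t (P n * f) = 0.
Proof.
have [L LE] := moment_linear 0 (leq0n 1) t_gt0.
(* The degree bound [m] is detached from [n], so that the induction strips off [P m] while [P n]
   stays fixed. *)
move=> sf; have [m mn {}sf] : exists2 m, (m <= n)%N & (size f <= m)%N by exists n.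
elim: m f mn sf => [|m IH] f mn sf.
  by have -> : f = 0; [apply/eqP; rewrite -size_poly_leq0|rewrite mulr0 -LE linear0].
rewrite -(subrK (f`_m *: P m) f) mulrDr -scalerAr -LE linearD/= scalarZ !LE.
rewrite IH ?size_sub_lead// 1?ltnW// P_orth_neq ?mulr0 ?addr0//.
by rewrite neq_ltn mn orbT.
Qed.

Lemma P_norm_gt0 n : 0 < moment 0 0 t (P n * P n).
Proof.
apply: moment_gt0 => //; first by rewrite mulf_neq0// monic_neq0// P_monic.
by move=> y _; rewrite hornerM -expr2 sqr_ge0.
Qed.

Lemma P_inj n (f g : {poly R}) : (size f <= n)%N -> (size g <= n)%N ->
  (forall k, (k < n)%N -> moment 0 0 t (f * P k) = moment 0 0 t (g * P k)) ->
  f = g.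
Proof.
have [L LE] := moment_linear 0 (leq0n 1) t_gt0.
elim: n f g => [|n IH] f g sf sg fg.
  apply/eqP; rewrite -subr_eq0 -size_poly_leq0.
  by rewrite (leq_trans (size_polyD _ _))// geq_max size_polyN sf.
have lead (e : {poly R}) : (size e <= n.+1)%N ->
    moment 0 0 t (e * P n) = e`_n * moment 0 0 t (P n * P n).
  move=> se; rewrite -{1}(subrK (e`_n *: P n) e) mulrDl -scalerAl.
  rewrite -LE linearD/= scalarZ !LE (mulrC (_ - _)).
  by rewrite (P_orth_size (size_sub_lead se)) add0r.
have fgn : f`_n = g`_n.
  have := fg n (ltnSn n); rewrite (lead _ sf) (lead _ sg) => /mulIf; apply.
  by rewrite gt_eqF// P_norm_gt0.
have : f - f`_n *: P n = g - g`_n *: P n.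
  apply: IH; rewrite ?size_sub_lead// => k kn.
  rewrite !mulrBl -!scalerAl -!LE !linearB/= !scalarZ !LE.
  by rewrite P_orth_neq ?mulr0 ?subr0 ?fg ?gtn_eqF// ltnW.
by rewrite fgn => /addIr.
Qed.

(** This recursion expresses [P n] through moments of polynomials of lower index, the form from
    which its dependence on [t] can be controlled. *)
Lemma gram_schmidt n : P n = 'X^n - \sum_(k < n)
  (moment 0 0 t ('X^n * P k) / moment 0 0 t (P k * P k)) *: P k.
Proof.
have [L LE] := moment_linear 0 (leq0n 1) t_gt0.
apply/eqP; rewrite eq_sym subr_eq addrC -subr_eq; apply/eqP.
apply: (@P_inj n) => [||j jn].
- have := @size_sub_lead 'X^n n; rewrite coefXn eqxx scale1r; apply.
  by rewrite size_polyXn.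
- apply: (leq_trans (size_sum _ _ _)); apply/bigmax_leqP => k _.
  by rewrite (leq_trans (size_scale_leq _ _))// P_size.
rewrite mulrBl -LE linearB/= !LE P_orth_neq ?gtn_eqF// subr0.
rewrite -[RHS]LE mulr_suml linear_sum/= (bigD1 (Ordinal jn))//= big1 ?addr0.
  by rewrite -scalerAl scalarZ !LE divfK// gt_eqF// P_norm_gt0.
move=> k kj; rewrite -scalerAl scalarZ LE.
by rewrite (@P_orth_neq k j) ?mulr0// -[j]/(val (Ordinal jn)) (inj_eq val_inj).
Qed.

End Orthogonal.

(** * Differentiability of the orthogonal polynomials in [t] *)

Variable P : R -> nat -> {poly R}.
Hypothesis P_orth : forall t, 0 < t ->
  monic_orthogonal_polynomials (weight alpha beta t) (P t).

(** Regularity in [t] is not assumed of [P]. It follows by strong induction, as the Gram-Schmidt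
    coefficients are quotients of differentiable moments with positive denominators. *)
Lemma poly_derive_P n t : 0 < t -> exists dP, poly_derive (P ^~ n) t dP.
Proof.
elim/ltn_ind: n => n IH t0.
have IHk (k : 'I_n) : exists dP, poly_derive (P ^~ k) t dP by exact: IH.
have [dP dPE] := choice IHk.
pose c (k : 'I_n) s := moment 0 0 s ('X^n * P s k) / moment 0 0 s (P s k * P s k).
have dc (k : 'I_n) : exists d, is_derive t 1 (c k) d.
  have d1 := is_derive_moment_path 0 (leq0n 1) t0
    (poly_deriveM (poly_derive_cst 'X^n t) (dPE k)).
  have d2 := is_derive_moment_path 0 (leq0n 1) t0 (poly_deriveM (dPE k) (dPE k)).
  have h0 : moment 0 0 t (P t k * P t k) != 0.
    by rewrite gt_eqF// (P_norm_gt0 t0 (P_orth t0)).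
  eexists; exact: is_deriveMR d1 (is_deriveV h0 d2).
have [dc' dcE] := choice dc.
have := poly_deriveD (poly_derive_cst 'X^n t) (poly_deriveZ (is_derive_cst (-1 : R) t 1)
  (poly_derive_sum (index_enum 'I_n) (fun k => poly_deriveZ (dcE k) (dPE k)))).
move=> d; eexists; apply: poly_derive_near d.
near=> s.
have s0 : 0 < s by near: s; exact: lt_nbhsr.
by rewrite (gram_schmidt s0 (P_orth s0) n) scaleN1r.
Unshelve. all: by end_near. Qed.

(* P_{n-1} / h_{n-1}, read as 0 for n = 0: it represents the functional
   f |-> f`_n.-1 on polynomials of degree less than n. *)
Definition dualP n s : {poly R} :=
  if n is m.+1 then (moment 0 0 s (P s m * P s m))^-1 *: P s m else 0.

Lemma dualP_size n s : 0 < s -> (size (dualP n s) <= n)%N.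
Proof.
move=> s0; case: n => [|n] /=; first by rewrite size_poly0.
by rewrite (leq_trans (size_scale_leq _ _))// (P_size (P_orth s0)).
Qed.

Lemma dualP_dual n s (f : {poly R}) : 0 < s -> (size f <= n)%N ->
  moment 0 0 s (dualP n s * f) = f`_n.-1.
Proof.
move=> s0; have [L LE] := moment_linear 0 (leq0n 1) s0.
case: n => [|n] sf /=.
  have -> : f = 0 by apply/eqP; rewrite -size_poly_leq0.
  by rewrite mulr0 -LE linear0 coef0.
rewrite -scalerAl -LE scalarZ -{1}(subrK (f`_n *: P s n) f) mulrDr -scalerAr.
rewrite linearD/= scalarZ !LE.
rewrite (P_orth_size s0 (P_orth s0) (size_sub_lead (P_orth s0) sf)).
rewrite add0r mulrCA mulVf ?mulr1// gt_eqF//.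
exact: (P_norm_gt0 s0 (P_orth s0)).
Qed.

Lemma poly_derive_dualP n t : 0 < t -> exists dq, poly_derive (dualP n) t dq.
Proof.
move=> t0; case: n => [|n].
  by exists 0; exact: poly_derive_cst.
have [dP dPE] := poly_derive_P n t0.
have h0 : moment 0 0 t (P t n * P t n) != 0.
  by rewrite gt_eqF// (P_norm_gt0 t0 (P_orth t0)).
have d2 := is_derive_moment_path 0 (leq0n 1) t0 (poly_deriveM dPE dPE).
by eexists; exact: poly_deriveZ (is_deriveV h0 d2) dPE.
Qed.

Section Fixed.
Variable n : nat.
Let p s := P s n.
Let q s := dualP n s.

Lemma is_derive_moments t : 0 < t -> exists dp dq : {poly R},
  [/\ poly_derive p t dp, poly_derive q t dq, (size dp <= n)%N, (size dq <= n)%N &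
    (forall f : {poly R}, (size f <= n)%N ->
      moment 0 0 t (dp * f) = moment 1 0 t (p t * f)) /\
    forall f : {poly R}, (size f <= n)%N ->
      moment 0 0 t (dq * f) = moment 1 0 t (q t * f)].
Proof.
move=> t0; have [dp dpE] := poly_derive_P n t0.
have [dq dqE] := poly_derive_dualP n t0.
have near0 : \forall s \near t, 0 < s by exact: lt_nbhsr.
exists dp, dq; split => //; last split.
(* The leading coefficient is constantly 1, so differentiation lowers the degree. *)
- have dpn : dp`_n = 0.
    have [_ d] := dpE; apply: (@is_derive_near_cst (fun s => (P s n)`_n) t 1 _ _ (d n)).
    near=> s; have s0 : 0 < s by near: s.
    exact: (P_coefn (P_orth s0)).
  have sdp : (size dp <= n.+1)%N.
    apply: (@poly_derive_size _ t dp n.+1 _ dpE); near=> s.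
    have s0 : 0 < s by near: s.
    by rewrite (P_size (P_orth s0)).
  apply/leq_sizeP => i; rewrite leq_eqVlt => /predU1P[<-//|ni].
  by rewrite nth_default// (leq_trans sdp).
- apply: (@poly_derive_size _ t dq n _ dqE); near=> s.
  have s0 : 0 < s by near: s.
  exact: dualP_size.
- move=> f sf; have d := is_derive_moment_path 0 (leq0n 1) t0
    (poly_deriveM dpE (poly_derive_cst f t)).
  apply: subr0_eq; have := @is_derive_near_cst _ t 0 _ _ d.
  rewrite mulr0 addr0; apply; near=> s.
  have s0 : 0 < s by near: s.
  exact: (P_orth_size s0 (P_orth s0)).
- move=> f sf; have d := is_derive_moment_path 0 (leq0n 1) t0
    (poly_deriveM dqE (poly_derive_cst f t)).
  apply: subr0_eq; have := @is_derive_near_cst _ t f`_n.-1 _ _ d.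
  rewrite mulr0 addr0; apply; near=> s.
  have s0 : 0 < s by near: s.
  exact: dualP_dual.
Unshelve. all: by end_near. Qed.

Let h s := moment 0 0 s (p s * p s).
Let r s := beta * moment 0 1 s (p s * p s) / h s.
Let A s := s * moment 1 0 s (p s * q s).
Let B s := beta * moment 0 1 s (p s * q s).

Lemma moment_pfrac t (f : {poly R}) : 0 < t ->
  moment 1 1 t f = moment 1 0 t f + moment 0 1 t f.
Proof.
move=> t0; have [L LE] := moment_linear 1 (leqnn 1) t0.
rewrite -(momentX alpha_gt0 beta_gt0 0 1) -(moment_onem alpha_gt0 beta_gt0 1).
by rewrite -!LE -linearD -mulrDl subrK mul1r.
Qed.

Lemma moment_Xonem t (f : {poly R}) : 0 < t ->
  moment 0 1 t ('X * f) = moment 0 1 t f - moment 0 0 t f.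
Proof.
move=> t0; have [L LE] := moment_linear 0 (leqnn 1) t0.
rewrite -(moment_onem alpha_gt0 beta_gt0 0) -!LE -linearB/= -{2}(mul1r f).
by rewrite -mulrBl subKr.
Qed.

Lemma riccati_orthogonal t : 0 < t -> riccati_at alpha beta n%:R r A B t.
Proof.
move=> t0; have [dp [dq [dpE dqE sdp sdq [Ldp Ldq]]]] := is_derive_moments t0.
(* The moments at this [t] are bundled as linear forms, which makes the abstract relations between
   functionals available. *)
have [L LE] := @choice _ _
  (fun k (F : {scalar {poly R}}) => forall f, F f = moment k 0 t f)
  (fun k => moment_linear k (leq0n 1) t0).
have [M ME] := moment_linear 0 (leqnn 1) t0.
have L_shift k f : L k.+1 ('X * f) = L k f by rewrite !LE; exact: momentX.
have M_shift f : M ('X * f) = M f - L 0%N f by rewrite !ME LE; exact: moment_Xonem.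
have L0_gt0 (f : {poly R}) : f != 0 ->
    (forall y, 0 <= y <= 1 -> 0 <= f.[y]) -> 0 < L 0%N f.
  by rewrite LE => f0 fy; exact: moment_gt0.
have ibp (f : {poly R}) :
    L 0%N (deriv f) + alpha * L 1%N f + t * L 2%N f - beta * M f = 0.
  by rewrite !LE ME; exact: moment_ibp.
have pm := P_monic (P_orth t0) n.
have ps := P_size (P_orth t0) n.
have qs := dualP_size n t0.
have op (f : {poly R}) : (size f <= n)%N -> L 0%N (p t * f) = 0.
  by rewrite LE; exact: (P_orth_size t0 (P_orth t0)).
have oq (f : {poly R}) : (size f <= n)%N -> L 0%N (q t * f) = f`_n.-1.
  by rewrite LE; exact: dualP_dual.
have Ldp' (f : {poly R}) : (size f <= n)%N -> L 0%N (dp * f) = L 1%N (p t * f).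
  by rewrite !LE; exact: Ldp.
have Ldq' (f : {poly R}) : (size f <= n)%N -> L 0%N (dq * f) = L 1%N (q t * f).
  by rewrite !LE; exact: Ldq.
have X0 : 0 < L 1%N (p t * p t).
  rewrite LE; apply: moment_gt0 => // [|y _].
    by rewrite mulf_neq0// monic_neq0.
  by rewrite hornerM -expr2 sqr_ge0.
have h0 : moment 0 0 t (p t * p t) != 0.
  by rewrite gt_eqF// (P_norm_gt0 t0 (P_orth t0)).
have dh := is_derive_moment_path 0 (leq0n 1) t0 (poly_deriveM dpE dpE).
have dX1 := is_derive_moment_path 0 (leqnn 1) t0 (poly_deriveM dpE dpE).
have dY1 := is_derive_moment_path 0 (leqnn 1) t0 (poly_deriveM dpE dqE).
have dY := is_derive_moment_path 1 (leq0n 1) t0 (poly_deriveM dpE dqE).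
have [kr [e1 e2 e3 e4]] := functional_riccati L_shift M_shift L0_gt0 ibp pm ps
  qs op oq sdp sdq Ldp' Ldq' t0 alpha_gt0 beta_gt0 X0.
have dr := is_deriveMR (is_derive_cst beta t 1) (is_deriveMR dX1 (is_deriveV h0 dh)).
have dA := is_deriveMR (is_derive_id t 1) dY.
have dB := is_deriveMR (is_derive_cst beta t 1) dY1.
move: e1 e2 e3 e4 kr dr dA dB; rewrite !LE !ME.
(* Differentiating the moments against [1/(1-y)] produced the kernel [1/(y(1-y))]; partial fractions
   bring it to the form used by the functionals. *)
rewrite !moment_pfrac// => e1 e2 e3 e4 kr dr dA dB.
do 3 eexists; split; first split.
- by apply: is_derive_congr dr _ erefl => s; rewrite /r mulrA.
- exact: dA.
- exact: dB.
- exact: kr.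
- rewrite -e1; congr (t * _).
  by rewrite /GRing.scale/= mul0r add0r; field.
- by rewrite mul0r add0r; exact: e2.
- split; last exact: e4.
  by rewrite mul0r add0r mul1r; exact: e3.
Qed.
End Fixed.

End PolyPath.

(** * From the first-order system to Painleve V *)

Lemma S_moment (R : realType) (alpha beta : R) (P : R -> nat -> {poly R}) n s :
  S_ alpha beta P n s = beta * moment alpha beta 0 1 s (P s n * P s n) /
    moment alpha beta 0 0 s (P s n * P s n) / (2 * n%:R + 1 + alpha + beta).
Proof.
rewrite /S_ /R_ /h_; congr (_ / _); rewrite mulrAC; congr (_ * _ / _).
- have e (y : R) : (P s n).[y] ^+ 2 * weight alpha beta s y / (1 - y) =
      (P s n * P s n).[y] * kern alpha beta 0 1 s y.
    rewrite hornerM /kern expr0 expr1 divr1.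
    by move: (weight _ _ _ _) (1 - y)^-1 => w v; ring.
  by apply: eq_Rintegral => y _; exact: e.
- have e (y : R) : (P s n).[y] ^+ 2 * weight alpha beta s y =
      (P s n * P s n).[y] * kern alpha beta 0 0 s y.
    by rewrite hornerM /kern !expr0 !divr1 expr2.
  by apply: eq_Rintegral => y _; exact: e.
Qed.

(** The system supplies first derivatives only. As it holds at every positive [s], it writes [S']
    near [t] as an explicit expression in [r], [A], [B], which can be differentiated once more. *)
Lemma painleve_of_riccati (R : realType) (alpha beta n : R)
    (r A B S : R -> R) (t : R) : 0 < 2 * n + 1 + alpha + beta ->
  (forall s, 0 < s -> riccati_at alpha beta n r A B s) ->
  (forall s, S s = r s / (2 * n + 1 + alpha + beta)) -> 0 < t ->
    derive1n 2 S t =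
      (3 * S t - 1) / (2 * S t * (S t - 1)) * derive1 S t ^+ 2
      - derive1 S t / t
      + (S t - 1) ^+ 2 / t ^+ 2 *
          ((2 * n + 1 + alpha + beta) ^+ 2 / 2 * S t
           - beta ^+ 2 / (2 * S t))
      + alpha * S t / t
      - S t * (S t + 1) / (2 * (S t - 1))
    /\ satisfies_PV ((2 * n + 1 + alpha + beta) ^+ 2 / 2)
         (- (beta ^+ 2 / 2)) alpha (- (1 / 2)) S t.
Proof.
move=> k0 sys SE0 t0; set k := 2 * n + 1 + alpha + beta in k0 SE0 *.
pose N s := 2 * (r s * A s - (r s - k) * B s) + (r s - beta) * (r s - k) - s * r s.
have SE : S = fun s => k^-1 * r s.
  by apply/funext => s; rewrite SE0 mulrC.
have dS (s : R) : 0 < s -> is_derive s 1 S (k^-1 * (N s * s^-1)).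
  move=> s0; have [dr [_ [_ [[rd _ _] _ drE _ _]]]] := sys s s0.
  rewrite SE; apply: is_derive_congr (is_deriveZ k^-1 rd) _ _ => //.
  by rewrite /GRing.scale/=; congr (_ * _); rewrite /N -drE mulrC mulKf ?gt_eqF.
have [dr [dA [dB [[rd Ad Bd] kr drE dBE [dAE rel]]]]] := sys t t0.
have tN0 : t != 0 by rewrite gt_eqF.
have cd c : is_derive t 1 (fun=> c : R) 0 by exact: is_derive_cst.
have rkd c := is_deriveB rd (cd c).
have Nd := is_deriveB (is_deriveD
  (is_deriveMR (cd 2) (is_deriveB (is_deriveMR rd Ad) (is_deriveMR (rkd k) Bd)))
  (is_deriveMR (rkd beta) (rkd k))) (is_deriveMR (is_derive_id t 1) rd).
have Fd := is_deriveMR (cd k^-1) (is_deriveMR Nd (is_deriveV tN0 (is_derive_id t 1))).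
have near0 : \forall s \near t, 0 < s by exact: lt_nbhsr.
have dSE (s : R) : 0 < s -> derive1 S s = k^-1 * (N s * s^-1).
  by move=> s0; rewrite derive1E; case: (dS s s0).
have NE : N t = t * dr by rewrite /N -drE.
pose dN := 2 * (dr * A t + r t * dA - dr * B t - (r t - k) * dB)
  + dr * (2 * r t - beta - k) - r t - t * dr.
(* Solves [dr + t * ddr = dN], the derivative of [t * dr = N]. *)
pose ddr := (dN - dr) / t.
have {}Fd : is_derive t 1 (fun s => k^-1 * (N s * s^-1)) (k^-1 * ddr).
  apply: is_derive_congr Fd _ _ => //; rewrite !fctE /GRing.scale/= -/(N t).
  rewrite mul0r add0r; congr (_ * _); rewrite NE /ddr /dN.
  by field.
have [ddS_ex ddSE] : is_derive t 1 (derive1 S) (k^-1 * ddr).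
  apply: near_eq_is_derive Fd.
  by near=> s; rewrite dSE//; near: s.
have [dS_ex _] := dS t t0.
have S1 : 1 < S t by rewrite SE mulrC ltr_pdivlMr// mul1r.
have S0 : 0 < S t by exact: lt_trans S1.
have rk0 : r t - k != 0 by rewrite subr_eq0 gt_eqF.
have r0 : r t != 0 by rewrite gt_eqF// (lt_trans k0).
have eN : dr + t * ddr = dN by rewrite /ddr mulrC divfK// addrC subrK.
have kN0 : k != 0 by rewrite gt_eqF.
have n2 : (2 : R) != 0 by rewrite pnatr_eq0.
have := painleve_elimination tN0 r0 rk0 kN0 n2 drE dBE dAE rel eN.
have d2S : derive1n 2 S t = ddr / k.
  by rewrite derive1nS derive1n1 derive1E ddSE mulrC.
have dSt : derive1 S t = dr / k.
  by rewrite dSE// NE mulrC [t * dr]mulrC mulfK.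
have St : S t = r t / k by rewrite SE mulrC.
rewrite -St -dSt -d2S -/k => ode; split; first exact: ode.
split => //; rewrite ?gt_eqF// ode.
(* The two forms differ by the partial fractions [(3 S - 1) / (2 S (S - 1)) = 1 / (2 S) + 1 / (S -
   1)] and by regrouping constants. *)
by field; rewrite subr_eq0 tN0 !gt_eqF.
Unshelve. all: by end_near. Qed.

Theorem theorem7p2 (R : realType) (alpha beta : R) (n : nat)
    (P : R -> nat -> {poly R})
    (alpha_gt0 : 0 < alpha) (beta_gt0 : 0 < beta)
    (P_orth : forall t : R, 0 < t ->
       monic_orthogonal_polynomials (weight alpha beta t) (P t)) :
  let S : R -> R := S_ alpha beta P n in
  forall t : R, 0 < t ->
    derive1n 2 S t =
      (3 * S t - 1) / (2 * S t * (S t - 1)) * derive1 S t ^+ 2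
      - derive1 S t / t
      + (S t - 1) ^+ 2 / t ^+ 2 *
          ((2 * n%:R + 1 + alpha + beta) ^+ 2 / 2 * S t
           - beta ^+ 2 / (2 * S t))
      + alpha * S t / t
      - S t * (S t + 1) / (2 * (S t - 1))
    /\ satisfies_PV ((2 * n%:R + 1 + alpha + beta) ^+ 2 / 2)
         (- (beta ^+ 2 / 2)) alpha (- (1 / 2)) S t.
Proof.
move=> S t t0.
have ric := riccati_orthogonal alpha_gt0 beta_gt0 P_orth n.
apply: (painleve_of_riccati _ ric) => //.
  by rewrite -!addrA ltr_wpDl ?mulr_ge0 ?addr_gt0.
by move=> s; rewrite /S S_moment.
Qed.
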